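(* Let $\theta>0$, $0<q<1$, let the success probabilities be $p_k=\theta/(\theta+k-1)$, $k\ge1$, and let the number of trials $N$ have the negative binomial distribution $\mathbb P(N=n)=\frac{(\theta)_n}{n!}(1-q)^\theta q^n$, $n\ge0$ (shape parameter equal to $\theta$). Then the point process of success epochs on $[0,1]$ is a Poisson process with rate function $$\frac{\theta}{t+q^{-1}-1},\qquad t\in[0,1].$$ With $\alpha^*=1-e^{-1/\theta}$ and $a^*=(1-\alpha^*/q)_+$, the strategy which skips all trials before time $a^*$ and then stops at the first success is optimal, and the optimal winning probability is $$-\theta(1-x)^\theta\log(1-x),\qquad x=q-(q-\alpha^* )_+ ,$$ hence equal to $1/e$ for $1-e^{-1/\theta}\le q<1$.
   Context: Notation: $(x)_n=x(x+1)\cdots(x+n-1)$, $(x)_0=1$; $y_+=\max(y,0)$. Model. Let $N,U_1,U_2,\dots$ be independent with $U_i$ uniform on $[0,1]$; $T_1<\dots<T_N$ are the ordered values of $U_1,\dots,U_N$ (the epochs of the trials). The trial at epoch $T_k$ is a success with probability $p_k$, independently of everything else; the success epochs are those $T_k$ for which the $k$th trial is a success. $\mathcal F_t$ is the $\sigma$-algebra generated by the epochs and outcomes of the trials on $[0,t]$. A stopping strategy is a random variable $\tau$ with values in $\{T_1,\dots,T_N,1\}$ with $\{\tau\le t\}\in\mathcal F_t$ for all $t\in[0,1]$; $\tau=1$ means not stopping. The strategy wins if $\tau=T_k$ for some $k$, the $k$th trial is a success and no later trial is a success. A strategy is optimal if it maximises the probability of winning over all stopping strategies. *)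

(* Defs.v *)
From HB Require Import structures.
From mathcomp Require Import all_boot all_order all_algebra.
From mathcomp Require Import all_classical all_reals all_analysis.

Set Implicit Arguments.
Unset Strict Implicit.
Unset Printing Implicit Defensive.

Import Order.TTheory GRing.Theory Num.Theory.
Import numFieldNormedType.Exports.

Local Open Scope classical_set_scope.
Local Open Scope ring_scope.

Definition rising_factorial (R : realType) (x : R) (n : nat) : R :=
  \prod_(i < n) (x + i%:R).

Definition negative_binomial_pmf (R : realType) (r q : R) (n : nat) : R :=
  rising_factorial r n / n`!%:R * (1 - q) `^ r * q ^+ n.

Definition generated_events (T : Type) d' (T' : measurableType d')
    (X : T -> T') : set (set T) :=
  preimage_set_system setT X measurable.

Definition mutually_independent d (T : measurableType d) (R : realType)
    (P : probability T R) (I : eqType) (G : I -> set (set T)) : Prop :=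
  forall (s : seq I) (A : I -> set T), uniq s ->
    (forall i, i \in s -> G i (A i)) ->
    P (\bigcap_(i in [set` s]) A i) = (\prod_(i <- s) P (A i))%E.

(* [M A w] is the number of points in [A].  Countable families of disjoint
   sets give the usual condition on finite families: independence only involves
   finite subfamilies, and a finite family can be padded with empty sets.  The
   mass function is spelled out because [poisson_pmf] is 1 at parameter 0. *)
Record poisson_process d (T : measurableType d) (R : realType)
    (P : probability T R) (M : set R -> T -> nat) (D : set R)
    (rate : R -> R) : Prop := PoissonProcess {
  poisson_rate_ge0 : forall t, D t -> 0 <= rate t;
  poisson_rate_integrable :
    (@lebesgue_measure R).-integrable D (EFin \o rate);
  poisson_count_measurable : forall A, measurable A -> A `<=` D ->
    measurable_fun setT (M A);
  poisson_count_law : forall A, measurable A -> A `<=` D -> forall n,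
    let m := \int[@lebesgue_measure R]_(t in A) rate t in
    P [set w | M A w = n] = (m ^+ n / n`!%:R * expR (- m))%:E;
  poisson_count_independent : forall A : nat -> set R,
    (forall i, measurable (A i)) -> (forall i, A i `<=` D) ->
    trivIset setT A ->
    mutually_independent P (fun i => generated_events (M (A i)))
}.

(* Indices start at 0: [U i] is the variable U_(i+1), [epoch N U k] is the order
   statistic T_(k+1) (meaningful for [k < N w] only), and [B k] tells whether
   the (k+1)-st trial in chronological order is a success. *)

Definition trial_events (T : Type) (R : realType) (N : T -> nat)
    (U : nat -> T -> R) (B : nat -> T -> bool) (i : option (nat + nat)) :
    set (set T) :=
  match i with
  | None => generated_events N
  | Some (inl j) => generated_events (U j)
  | Some (inr k) => generated_events (B k)
  end.

(* [nu] is the law of the number of trials and [p k], for [k >= 1], the success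
   probability of the k-th trial; [p 0] is never used.  The variables [U i] are
   [0, 1]-valued everywhere, not just almost surely, because the history below
   is not completed with null sets. *)
Record trials_model d (T : measurableType d) (R : realType)
    (P : probability T R) (nu p : nat -> R) (N : {RV P >-> nat})
    (U : nat -> {RV P >-> R}) (B : nat -> {RV P >-> bool}) : Prop :=
  TrialsModel {
  number_law : forall n, P [set w | N w = n] = (nu n)%:E;
  uniform_range : forall i w, 0 <= U i w <= 1;
  uniform_law : forall i (A : set R), measurable A ->
    P (U i @^-1` A) = uniform_prob (@ltr01 R) A;
  success_law : forall k, P [set w | B k w] = (p k.+1)%:E;
  trials_independent : mutually_independent P (trial_events N U B)
}.

Definition epoch (T : Type) (R : realType) (N : T -> nat) (U : nat -> T -> R)
    (k : nat) (w : T) : R :=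
  nth 0 (sort <=%O [seq U i w | i <- iota 0 (N w)]) k.

Definition success_epochs (T : Type) (R : realType) (N : T -> nat)
    (U : nat -> T -> R) (B : nat -> T -> bool) (w : T) : seq R :=
  [seq epoch N U k w | k <- iota 0 (N w) & B k w].

Definition success_count (T : Type) (R : realType) (N : T -> nat)
    (U : nat -> T -> R) (B : nat -> T -> bool) (A : set R) (w : T) : nat :=
  count (fun t => t \in A) (success_epochs N U B w).

(* The sigma-algebra generated by the epochs and outcomes of the trials on
   [0, t]: for each [s <= t], it records which trials have occurred by [s] and
   which of these were successes. *)
Definition history (T : Type) (R : realType) (N : T -> nat)
    (U : nat -> T -> R) (B : nat -> T -> bool) (t : R) : set (set T) :=
  <<s [set A | exists (k : nat) (s : R), 0 <= s <= t /\
        (A = [set w | (k < N w)%N /\ epoch N U k w <= s] \/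
         A = [set w | [/\ (k < N w)%N, epoch N U k w <= s & B k w]])] >>.

Record stopping_strategy d (T : measurableType d) (R : realType)
    (N : T -> nat) (U : nat -> T -> R) (B : nat -> T -> bool)
    (tau : T -> R) : Prop := StoppingStrategy {
  strategy_measurable : measurable_fun setT tau;
  strategy_range : forall w,
    tau w = 1 \/ exists2 k, (k < N w)%N & tau w = epoch N U k w;
  strategy_adapted : forall t, 0 <= t <= 1 ->
    history N U B t [set w | tau w <= t]
}.

Definition winning_event (T : Type) (R : realType) (N : T -> nat)
    (U : nat -> T -> R) (B : nat -> T -> bool) (tau : T -> R) : set T :=
  [set w | exists k, [/\ (k < N w)%N, tau w = epoch N U k w, B k w &
                         forall j, (k < j < N w)%N -> ~~ B j w]].

Definition optimal_strategy d (T : measurableType d) (R : realType)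
    (P : probability T R) (N : T -> nat) (U : nat -> T -> R)
    (B : nat -> T -> bool) (tau : T -> R) : Prop :=
  stopping_strategy N U B tau /\
  forall sigma, stopping_strategy N U B sigma ->
    (P (winning_event N U B sigma) <= P (winning_event N U B tau))%E.

Definition optimal_winning_probability d (T : measurableType d) (R : realType)
    (P : probability T R) (N : T -> nat) (U : nat -> T -> R)
    (B : nat -> T -> bool) : \bar R :=
  ereal_sup [set P (winning_event N U B tau) |
             tau in [set tau | stopping_strategy N U B tau]].

(* Success epochs are listed in increasing order, so the head is the first
   success from time [a] on. *)
Definition threshold_strategy (T : Type) (R : realType) (N : T -> nat)
    (U : nat -> T -> R) (B : nat -> T -> bool) (a : R) (w : T) : R :=
  head 1 [seq t <- success_epochs N U B w | a <= t].

(* Main.v *)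
Require Import Defs.
From HB Require Import structures.
From mathcomp Require Import all_boot all_order all_algebra.
From mathcomp Require Import all_classical all_reals all_analysis.
From mathcomp Require Import measurable_realfun.
From mathcomp Require Import ring lra.

Set Implicit Arguments.
Unset Strict Implicit.
Unset Printing Implicit Defensive.

Import Order.TTheory GRing.Theory Num.Theory.
Import numFieldNormedType.Exports.

Local Open Scope classical_set_scope.
Local Open Scope ring_scope.

(** The heart of the proof is an identity valid for step functions.  Cut the
    line into cells and let [l i] be the probability that a uniform point falls
    into cell [i].  Given [n] trials, a pattern of outcomes has a probability
    with denominator [(theta)_n]: the k-th trial contributes [theta] for a
    success and [k - 1] for a failure.  As the negative binomial law has shape
    [theta], its factor [(theta)_n] cancels this denominator.  If [phi i] is
    attached to every success in cell [i], the expected product of these weights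
    is therefore [(1 - q)^theta] times the sum over [n] of [q^n / n!] times a sum
    over the words of cells.  Summing over the number [r] of trials in the last
    cell [M], on top of [m] earlier ones, involves only the negative binomial
    series
      [sum_r (m + theta * phi M)_r / r! * (q * l M)^r
         = (1 - q * l M)^-(m + theta * phi M)],
    which amounts to a constant factor and to replacing [q] by
    [q / (1 - q * l M)] in the sum over the remaining cells.  Peeling the cells
    one by one from the right makes the product telescope
    ([wseries_peel], [wseries_future]).  With
      [hazard x = - theta * ln (1 - q * (1 - x))],
    the integral of the rate over [x, 1], the cells from [r0] on contribute
    [exp (- sum_i (1 - phi i) * (hazard increment of cell i))], and what is left
    is the probability of whatever was prescribed about the trials in the cells
    before [r0] ([expectation_past_future]).

    Poisson process.  For [r0 = 0] this is the generating functional of a Poisson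
    process on step functions.  Dominated convergence extends it to the iterated
    pointwise limits of step functions with values in the unit interval
    ([expectation_success_prod]), among them the functions constant on each of
    finitely many disjoint Borel sets and equal to 1 elsewhere.  Hence the joint
    generating function of the counts in disjoint Borel sets is a product of
    Poisson ones ([count_pgf]); uniqueness of power series coefficients, used for
    one variable at a time, turns it into the joint law ([count_joint]).

    Independence of the past.  For a grid ending at [t] the same identity
    prescribes an arbitrary event about the trials up to [t].  Such events are
    stable under intersection and generate a sigma-algebra containing the history
    up to [t], so the absence of successes between [t] and a later time is
    independent of the history ([history_independent]).

    Optimality.  Cut the time interval into [n + 1] cells carrying the same
    integrated rate [h], numbered from the right.  For a strategy let [y m] be the
    probability that it has not stopped before the last [m] cells begin, and
    [x m] the probability that it stops in cell [m] while that cell contains a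
    success.  Independence of the past gives
    [x m <= (1 - exp (- h)) * y (m + 1)], and winning inside cell [m] has
    probability at most [x m * exp (- m * h)].  Together with
    [x m <= y (m + 1) - y m] this is a linear program whose dual solution is the
    value of the discrete last-success problem ([odds_value], [odds_value_dual]).
    That value exceeds the maximum of [u * exp (- u)] over [0 <= u <= H], where
    [H] is the total integrated rate, by a factor at most [exp h]
    ([odds_value_le]), and [n] is arbitrary ([strategy_upper_bound]).  The
    threshold strategy started at [a] wins at least when there is exactly one
    success in [a, 1], which has probability [u * exp (- u)] for
    [u = hazard a]; the threshold of the statement is the one with
    [u = min H 1], where the maximum is attained ([threshold_value]). *)

(** * The negative binomial series *)

Definition nb_coef (R : realType) (a : R) (n : nat) : R :=
  rising_factorial a n / n`!%:R.

Lemma rising_factorialS (R : realType) (a : R) n :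
  rising_factorial a n.+1 = rising_factorial a n * (a + n%:R).
Proof. by rewrite /rising_factorial big_ord_recr. Qed.

Lemma rising_factorial0 (R : realType) (a : R) : rising_factorial a 0 = 1.
Proof. by rewrite /rising_factorial big_ord0. Qed.

Lemma rising_factorial_ge0 (R : realType) (a : R) n :
  0 <= a -> 0 <= rising_factorial a n.
Proof. by move=> a0; apply: prodr_ge0 => i _; rewrite addr_ge0. Qed.

Lemma rising_factorial_recl (R : realType) (a : R) n :
  rising_factorial a n.+1 = a * rising_factorial (a + 1) n.
Proof.
rewrite /rising_factorial big_ord_recl addr0; congr (_ * _).
by apply: eq_bigr => i _; rewrite lift0 -addrA nat1r.
Qed.

Lemma nb_coef_ge0 (R : realType) (a : R) n : 0 <= a -> 0 <= nb_coef a n.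
Proof. by move=> a0; rewrite divr_ge0// rising_factorial_ge0. Qed.

Lemma nb_coefS (R : realType) (a : R) n :
  n.+1%:R * nb_coef a n.+1 = (a + n%:R) * nb_coef a n.
Proof.
rewrite /nb_coef rising_factorialS factS natrM invfM.
have h : n.+1%:R != 0 :> R by rewrite pnatr_eq0.
have h' : n`!%:R != 0 :> R by rewrite pnatr_eq0 -lt0n fact_gt0.
by field; rewrite h' nat1r h.
Qed.

Lemma nb_coefS_shift (R : realType) (a : R) n :
  n.+1%:R * nb_coef a n.+1 = a * nb_coef (a + 1) n.
Proof.
rewrite /nb_coef rising_factorial_recl factS natrM invfM.
have h : n.+1%:R != 0 :> R by rewrite pnatr_eq0.
have h' : n`!%:R != 0 :> R by rewrite pnatr_eq0 -lt0n fact_gt0.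
by field; rewrite h' nat1r h.
Qed.

Section NegativeBinomialSeries.
Variables (R : realType) (a : R).
Hypothesis a_ge0 : 0 <= a.

Let psum n (x : R) := \sum_(k < n) nb_coef a k * x ^+ k.
Let dpsum n (x : R) := \sum_(k < n) nb_coef a k * (k%:R * x ^+ k.-1).

Let is_derive_psum n (x : R) : is_derive x (1 : R) (psum n) (dpsum n x).
Proof.
have -> : psum n = \sum_(k < n) (nb_coef a k \*: (@id R ^+ k)).
  by apply/funext => y; rewrite /psum fct_sumE; apply: eq_bigr => k _; rewrite fctE.
apply: is_derive_sum => k.
suff -> : nb_coef a k * (k%:R * x ^+ k.-1) =
    nb_coef a k *: ((k%:R * @id R x ^+ k.-1) *: 1) by exact: is_deriveZ.
by rewrite /GRing.scale /= mulr1.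
Qed.

(* The partial sums satisfy the differential equation of [(1 - x)^-a] up to a
   single term. *)
Let psum_ode n (x : R) :
  (1 - x) * dpsum n x - a * psum n x = - (n%:R * nb_coef a n * x ^+ n.-1).
Proof.
elim: n => [|n IHn]; first by rewrite /psum /dpsum !big_ord0; ring.
rewrite /psum /dpsum !big_ord_recr /= -/(psum n x) -/(dpsum n x).
rewrite nb_coefS; move: IHn => /(congr1 (+%R (n%:R * nb_coef a n * x ^+ n.-1))).
rewrite addrN => IHn.
case: n IHn => [|n] /= IHn; first by rewrite /psum /dpsum !big_ord0; ring.
apply/eqP; rewrite -subr_eq0 -[X in _ == X]IHn; apply/eqP.
move: (dpsum _ _) (psum _ _) (nb_coef _ _) => u v c.
rewrite exprS; move: (x ^+ n) (n.+1%:R) => y m; ring.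
Qed.

Let phi n (x : R) := (1 - x) `^ a * psum n x.

Let is_derive_phi n (x : R) : x < 1 ->
  is_derive x (1 : R) (phi n)
    (- (n%:R * nb_coef a n * x ^+ n.-1 * (1 - x) `^ (a - 1))).
Proof.
move=> x1; have x1' : 0 < 1 - x by rewrite subr_gt0.
have d1 : is_derive x (1 : R) (fun y : R => (1 - y) `^ a)
    (- (a * (1 - x) `^ (a - 1))).
  have dp := is_derive1_powR a x1'.
  have : is_derive x (1:R) (fun y : R => 1 - y) (-1).
    by rewrite -[-1]add0r; exact: is_deriveB.
  move=> d; rewrite -(mulrN1 (a * _)).
  exact: (@is_derive1_comp _ (fun y => y `^ a) (fun y : R => 1 - y)).
have := is_deriveM d1 (is_derive_psum n x).
congr is_derive; rewrite /GRing.scale /=.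
have -> : (1 - x) `^ a = (1 - x) * (1 - x) `^ (a - 1).
  rewrite -{2}(powRr1 (ltW x1')) -powRD; last by rewrite (gt_eqF x1') implybT.
  by congr (_ `^ _); ring.
have /(congr1 (fun z => z * (1 - x) `^ (a - 1))) := psum_ode n x.
move: (dpsum _ _) (psum _ _) (n%:R * _ * _) (_ `^ _) => u v c p h.
by rewrite -(mulNr c) -h; ring.
Qed.

(* Hence [(1 - x)^a] times a partial sum has an explicit one-term derivative,
   and its distance to 1 is read off from the mean value theorem. *)
Let phi_mvt n (x : R) : 0 <= x < 1 -> exists2 t, 0 <= t <= x &
  1 - phi n.+1 x = n.+1%:R * nb_coef a n.+1 * t ^+ n * (1 - t) `^ (a - 1) * x.
Proof.
move=> /andP[x0 x1].
have [||c] := @MVT_segment R (phi n.+1)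
  (fun x => - (n.+1%:R * nb_coef a n.+1 * x ^+ n * (1 - x) `^ (a - 1))) 0 x x0.
- by move=> y; rewrite in_itv /= => /andP[_ yx]; exact: is_derive_phi (lt_trans yx x1).
- apply: derivable_within_continuous => y; rewrite in_itv /= => /andP[_ yx].
  by have [] := is_derive_phi n.+1 (le_lt_trans yx x1).
rewrite in_itv /= => cx H; exists c => //.
have phi0 : phi n.+1 0 = 1.
  rewrite /phi subr0 powR1 mul1r /psum big_ord_recl /= /nb_coef.
  rewrite rising_factorial0 fact0 divr1 mulr1 big1 ?addr0// => i _.
  by rewrite expr0n /= mulr0.
by move: H; rewrite phi0 subr0 -opprB => /(canRL (@opprK _)) ->; ring.
Qed.

Lemma nb_psum_le n (x : R) : 0 <= x < 1 ->
  \sum_(k < n) nb_coef a k * x ^+ k <= (1 - x) `^ (- a).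
Proof.
move=> x01; have x1 : 0 < 1 - x by lra.
have p0 : 0 < (1 - x) `^ a by rewrite powR_gt0.
rewrite powRN -div1r ler_pdivlMr // mulrC -/(phi n x).
case: n => [|n]; first by rewrite /phi /psum big_ord0 mulr0.
rewrite -subr_ge0; have [t /andP[t0 _] ->] := phi_mvt n x01.
have /andP[x0 _] := x01.
rewrite mulr_ge0// mulr_ge0 ?powR_ge0// mulr_ge0 ?exprn_ge0//.
by rewrite mulr_ge0 ?nb_coef_ge0.
Qed.

(** The bound is the general term of the series for [a + 1], which converges
    because its partial sums are bounded; so the defect tends to 0. *)
Lemma nb_psum_defect n (x : R) : 0 <= x < 1 ->
  1 - (1 - x) `^ a * \sum_(k < n.+1) nb_coef a k * x ^+ k <=
  a / (1 - x) * (nb_coef (a + 1) n * x ^+ n).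
Proof.
move=> x01; have [t /andP[t0 tx] E] := phi_mvt n x01.
have /andP[x0 x1] := x01.
rewrite -/(phi n.+1 x) E nb_coefS_shift.
have c0 : 0 <= a * nb_coef (a + 1) n by rewrite mulr_ge0 ?nb_coef_ge0 ?addr_ge0.
rewrite [leRHS](_ : _ = a * nb_coef (a + 1) n * x ^+ n * (1 - x)^-1 * 1); last by ring.
have t1 : 0 < 1 - t by lra.
apply: ler_pM; rewrite ?mulr_ge0 ?exprn_ge0 ?powR_ge0 ?invr_ge0 ?rising_factorial_ge0 ?addr_ge0 //; [|lra].
apply: ler_pM; rewrite ?mulr_ge0 ?exprn_ge0 ?powR_ge0 ?invr_ge0 ?rising_factorial_ge0 ?addr_ge0 //.
  by rewrite ler_wpM2l// lerXn2r// nnegrE (le_trans t0).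
apply: (@le_trans _ _ ((1 - t) `^ (-1))).
  by apply: ger_powR; [apply/andP; split; lra|move: a_ge0; lra].
by rewrite (powR_inv1 (ltW t1)) lef_pV2 ?posrE//; lra.
Qed.
End NegativeBinomialSeries.

Lemma is_cvg_nb_series (R : realType) (a x : R) : 0 <= a -> 0 <= x < 1 ->
  cvgn (series (fun k => nb_coef a k * x ^+ k)).
Proof.
move=> a0 x01; apply: nondecreasing_is_cvgn.
  apply/nondecreasing_seqP => n; rewrite /series /= big_nat_recr//= lerDl.
  by have /andP[x0 _] := x01; rewrite mulr_ge0 ?nb_coef_ge0 ?exprn_ge0.
by exists ((1 - x) `^ (- a)) => _ [n _ <-]; rewrite /series /= big_mkord nb_psum_le.
Qed.

Lemma nb_series (R : realType) (a x : R) : 0 <= a -> 0 <= x < 1 ->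
  (\sum_(n <oo) (nb_coef a n * x ^+ n)%:E = ((1 - x) `^ (- a))%:E)%E.
Proof.
move=> a0 x01; have /andP[x0 x1] := x01.
have p0 : 0 < (1 - x) `^ a by rewrite powR_gt0// subr_gt0.
set u := fun k => nb_coef a k * x ^+ k.
set v := fun k => nb_coef (a + 1) k * x ^+ k.
have cu : series u @ \oo --> (1 - x) `^ (- a).
  have v0 : v @ \oo --> 0.
    by apply: cvg_series_cvg_0; apply: is_cvg_nb_series; rewrite ?addr_ge0.
  set p := (1 - x) `^ a in p0 *.
  have d0 : (fun n => 1 - p * series u n.+1) @ \oo --> (0 : R).
    apply: (@squeeze_cvgr _ _ _ _ (fun=> 0) (fun n => a / (1 - x) * v n)).
    - apply: nearW => n; rewrite /series /= big_mkord nb_psum_defect// andbT.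
      by rewrite subr_ge0 mulrC -ler_pdivlMr// div1r -powRN nb_psum_le.
    - exact: cvg_cst.
    - have := cvgM (cvg_cst (a / (1 - x))) v0; rewrite mulr0; exact.
  have d1 : (fun n => p^-1 * (1 - (1 - p * series u n.+1))) @ \oo --> p^-1 * (1 - 0).
    by apply: cvgM; [exact: cvg_cst|apply: cvgB => //; exact: cvg_cst].
  rewrite -(cvg_shiftS (series u)) powRN -/p.
  rewrite subr0 mulr1 in d1; apply: cvg_trans d1; apply: near_eq_cvg.
  by apply: nearW => n; rewrite opprB addrCA subrr addr0 mulrA mulVf ?mul1r// gt_eqF.
rewrite -(cvg_lim _ cu)// -EFin_lim; last by apply/cvg_ex; exists ((1 - x) `^ (- a)).
by apply: congr_lim; apply/funext => n; rewrite /= /series /= sumEFin.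
Qed.

(** * Sums over words of cells *)
Section EwensWords.
Variables (R : realType) (l : nat -> R).

(** The sum of [l c_1 * ... * l c_n * F c] over the words [c] of length [n] on
    the letters [0, ..., M - 1]. *)
Fixpoint wsum M n (F : seq nat -> R) : R :=
  if n is n'.+1 then \sum_(i < M) l i * wsum M n' (fun c => F (val i :: c))
  else F [::].

Lemma eq_wsum M n (F G : seq nat -> R) :
  (forall c, size c = n -> all (fun i => i < M)%N c -> F c = G c) ->
  wsum M n F = wsum M n G.
Proof.
elim: n F G => [|n IHn] F G FG /=; first exact: FG.
apply: eq_bigr => i _; congr (_ * _); apply: IHn => c sc ac.
by apply: FG => /=; rewrite ?sc ?ltn_ord.
Qed.

Lemma wsumZ M n k (F : seq nat -> R) :
  wsum M n (fun c => k * F c) = k * wsum M n F.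
Proof.
elim: n F => [//|n IHn] F /=; rewrite mulr_sumr.
by apply: eq_bigr => i _; rewrite IHn mulrCA.
Qed.

Lemma wsum_ge0 M n (F : seq nat -> R) : (forall i, 0 <= l i) ->
  (forall c, 0 <= F c) -> 0 <= wsum M n F.
Proof.
move=> l0; elim: n F => [|n IHn] F F0 /=; first exact: F0.
by apply: sumr_ge0 => i _; rewrite mulr_ge0 ?l0 ?IHn.
Qed.

(** A word is determined by the positions of its letters [M] and the word formed
    by the others; for a symmetric [F] only their number [r] matters. *)
Lemma wsum_peel M n (F : seq nat -> R) :
  (forall c c', perm_eq c c' -> F c = F c') ->
  wsum M.+1 n F =
  \sum_(r < n.+1) 'C(n, r)%:R * l M ^+ r * wsum M (n - r) (fun c => F (nseq r M ++ c)).
Proof.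
elim: n F => [|n IHn] F Fp; first by rewrite big_ord1 bin0 expr0 !mul1r.
pose W r := wsum M (n.+1 - r) (fun c => F (nseq r M ++ c)).
have step i : wsum M.+1 n (fun c => F (i :: c)) = \sum_(r < n.+1)
    'C(n, r)%:R * l M ^+ r * wsum M (n - r) (fun c => F (nseq r M ++ i :: c)).
  rewrite IHn; last by move=> c c' cc'; apply: Fp; rewrite perm_cons.
  apply: eq_bigr => r _; congr (_ * _); apply: eq_wsum => c _ _; apply: Fp.
  exact: (permEl (perm_catCA [:: i] (nseq r M) c)).
rewrite [LHS]/= big_ord_recr /= (step M) mulr_sumr.
under eq_bigr do rewrite step mulr_sumr.
rewrite exchange_big /=.
have -> : \sum_(r < n.+1) \sum_(i < M) l i * ('C(n, r)%:R * l M ^+ r *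
    wsum M (n - r) (fun c => F (nseq r M ++ val i :: c))) =
    \sum_(r < n.+1) 'C(n, r)%:R * l M ^+ r * W r.
  apply: eq_bigr => r _; rewrite /W subSn ?leq_ord//= mulr_sumr.
  by apply: eq_bigr => i _; rewrite mulrCA.
have -> : \sum_(r < n.+1) l M * ('C(n, r)%:R * l M ^+ r *
    wsum M (n - r) (fun c => F (nseq r M ++ M :: c))) =
    \sum_(r < n.+1) 'C(n, r)%:R * l M ^+ r.+1 * W r.+1.
  apply: eq_bigr => r _; rewrite /W subSS exprS.
  under [wsum _ _ (fun c => F (nseq r.+1 M ++ c))]eq_wsum => c _ _.
    rewrite (_ : nseq r.+1 M ++ c = nseq r M ++ M :: c).
  over.
    by rewrite -[r.+1]addn1 nseqD -catA.
  by rewrite !mulrA [l M * _]mulrC.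
rewrite [RHS]big_ord_recl /= bin0 expr0.
rewrite [X in X + _]big_ord_recl /= bin0 expr0 -!addrA; congr (_ + _).
rewrite [X in _ = X](_ : _ = \sum_(r < n.+1) ('C(n, r.+1)%:R * l M ^+ r.+1 * W r.+1)
  + \sum_(r < n.+1) 'C(n, r)%:R * l M ^+ r.+1 * W r.+1); last first.
  rewrite -big_split /=; apply: eq_bigr => r _.
  by rewrite /bump /= add1n binS natrD !mulrDl.
congr (_ + _); rewrite [RHS]big_ord_recr /= bin_small// !mul0r addr0.
by apply: eq_bigr.
Qed.

End EwensWords.

Local Open Scope ereal_scope.

Lemma nneseries_fin (R : realType) (f : nat -> \bar R) n :
  (forall k, 0 <= f k) -> (forall k, (n <= k)%N -> f k = 0) ->
  \sum_(k <oo) f k = \sum_(k < n) f k.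
Proof.
move=> f0 fn; rewrite (nneseries_split 0 n)// add0n.
rewrite eseries0 ?adde0 ?big_mkord// => k nk _.
exact: fn.
Qed.

(** Both sides sum [A] over all pairs; on the left they are grouped by the
    antidiagonals [k + r = n]. *)
Lemma nneseries_triangle (R : realType) (A : nat -> nat -> \bar R) :
  (forall k r, 0 <= A k r) ->
  \sum_(n <oo) \sum_(r < n.+1) A (n - r)%N r = \sum_(k <oo) \sum_(r <oo) A k r.
Proof.
move=> A0; pose a n r := if (r <= n)%N then A (n - r)%N r else 0.
have a0 n r : 0 <= a n r by rewrite /a; case: ifP.
transitivity (\sum_(n <oo) \sum_(r <oo) a n r).
  apply: eq_eseriesr => n _; rewrite (@nneseries_fin _ _ n.+1)//.
    by apply: eq_bigr => r _; rewrite /a leq_ord.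
  by move=> r nr; rewrite /a leqNgt nr.
rewrite nneseries_interchange// [RHS]nneseries_interchange//.
apply: eq_eseriesr => r _; rewrite (nneseries_split 0 r)// add0n big_mkord.
rewrite big1 ?add0e; last by move=> i _; rewrite /a leqNgt ltn_ord.
by rewrite -nneseries_addn//; apply: eq_eseriesr => k _; rewrite /a leq_addl addnK.
Qed.

(** The exponential generating function of the word sums, in which [x ^ n / n!]
    comes from the negative binomial law of the number of trials. *)
Definition wseries (R : realType) (l : nat -> R) (x : R) M (F : seq nat -> R) :=
  \sum_(n <oo) (x ^+ n / n`!%:R * wsum l M n F)%:E.

(** Summing out the largest letter.  The rising factorial makes the sum over its
    multiplicity a negative binomial series, and the part of the exponent that
    depends on the number of remaining letters is absorbed by the new argument
    [x / (1 - x * l M)]. *)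
Lemma wseries_peel (R : realType) (l : nat -> R) (x b : R) M (F G : seq nat -> R) :
  (forall i, 0 <= l i)%R -> (forall c, 0 <= G c)%R -> (0 <= x)%R ->
  (x * l M < 1)%R -> (0 <= b)%R ->
  (forall c c', perm_eq c c' -> F c = F c') ->
  (forall r c, all (fun i => i < M)%N c ->
    F (nseq r M ++ c) = G c * rising_factorial ((size c)%:R + b) r)%R ->
  wseries l x M.+1 F =
  ((1 - x * l M) `^ (- b))%:E * wseries l (x / (1 - x * l M)) M G.
Proof.
move=> l0 G0 x0 xl1 b0 Fp FG.
pose w k := (x ^+ k / k`!%:R * wsum l M k G)%R.
have w0 k : (0 <= w k)%R.
  by rewrite /w !mulr_ge0 ?exprn_ge0 ?invr_ge0 ?wsum_ge0.
have d0 : (0 < 1 - x * l M)%R by rewrite subr_gt0.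
have xl0 : (0 <= x * l M)%R by rewrite mulr_ge0.
transitivity (\sum_(k <oo) \sum_(r <oo)
    (w k * (nb_coef (k%:R + b) r * (x * l M) ^+ r))%:E); last first.
  rewrite /wseries -nneseriesZl; last first.
    by move=> k _; rewrite lee_fin mulr_ge0 ?wsum_ge0// mulr_ge0 ?exprn_ge0// divr_ge0// ltW.

  apply: eq_eseriesr => k _; under eq_eseriesr do rewrite EFinM.
  rewrite nneseriesZl; last first.
    by move=> i _; rewrite lee_fin mulr_ge0 ?nb_coef_ge0 ?exprn_ge0 ?addr_ge0.
  rewrite nb_series ?addr_ge0 ?xl0 ?xl1// -!EFinM; congr EFin.
  rewrite opprD powRD; last by rewrite (gt_eqF d0) implybT.
  rewrite powR_invn ?(ltW d0)// /w expr_div_n.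
  by move: ((1 - x * l M) `^ (- b))%R => u; ring.
rewrite -nneseries_triangle; last first.
  move=> k r; rewrite lee_fin mulr_ge0// mulr_ge0 ?exprn_ge0// nb_coef_ge0//.
  by rewrite addr_ge0.
apply: eq_eseriesr => n _; rewrite sumEFin; congr EFin.
rewrite wsum_peel// mulr_sumr; apply: eq_bigr => r _.
have rn : (r <= n)%N by rewrite leq_ord.
rewrite (@eq_wsum _ _ _ _ _ (fun c => rising_factorial ((n - r)%:R + b) r * G c)%R);
  last by move=> c sc ac; rewrite FG// sc mulrC.
rewrite wsumZ /w /nb_coef exprMn; move: (nat_of_ord r) rn => {}r rn.
rewrite -(bin_fact rn) -{1}(subnK rn) exprD !natrM.
have h1 : (r`!%:R != 0 :> R)%R by rewrite pnatr_eq0 -lt0n fact_gt0.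
have h2 : ((n - r)`!%:R != 0 :> R)%R by rewrite pnatr_eq0 -lt0n fact_gt0.
have h3 : ('C(n, r)%:R != 0 :> R)%R by rewrite pnatr_eq0 -lt0n bin_gt0.
by field; rewrite h1 h2 h3.
Qed.
Local Close Scope ereal_scope.

(** * Sums over outcomes of the trials *)
Section EwensOutcomes.
Variables (R : realType) (theta : R).

(** The sum over all outcomes of trials located in the cells [s], when [k] trials
    came before: a success weighs [theta] and a failure the number of preceding
    trials.  These are the probabilities of the model without their
    denominators. *)
Fixpoint osum k (s : seq nat) (F : seq (nat * bool) -> R) : R :=
  if s is i :: s' then
    theta * osum k.+1 s' (fun z => F ((i, true) :: z)) +
    k%:R * osum k.+1 s' (fun z => F ((i, false) :: z))
  else F [::].

Lemma eq_osum k s (F G : seq (nat * bool) -> R) :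
  (forall z, unzip1 z = s -> F z = G z) -> osum k s F = osum k s G.
Proof.
elim: s k F G => [|i s IHs] k F G FG /=; first exact: FG.
by congr (_ * _ + _ * _); apply: IHs => z sz; apply: FG; rewrite /= sz.
Qed.

Lemma osumZ k s c (F : seq (nat * bool) -> R) :
  osum k s (fun z => F z * c) = osum k s F * c.
Proof. by elim: s k F => [//|i s IHs] k F /=; rewrite !IHs; ring. Qed.

Lemma osum_cat k s s' (F : seq (nat * bool) -> R) :
  osum k (s ++ s') F =
  osum k s (fun z => osum (k + size s) s' (fun z' => F (z ++ z'))).
Proof.
elim: s k F => [|i s IHs] k F /=; first by rewrite addn0.
by rewrite !IHs addnS -addSn.
Qed.

Lemma osum_ge0 k s (F : seq (nat * bool) -> R) : 0 <= theta ->
  (forall z, 0 <= F z) -> 0 <= osum k s F.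
Proof.
move=> t0; elim: s k F => [|i s IHs] k F F0 /=; first exact: F0.
by rewrite addr_ge0// mulr_ge0// IHs.
Qed.

Variables (r0 : nat) (phi : nat -> R) (Q : seq (nat * bool) -> bool).

Definition past_trials (z : seq (nat * bool)) :=
  [seq x <- z | (x.1 < r0)%N].

(** For a chronological list of trials, given by cell and outcome: the indicator
    of an event [Q] about the trials in the cells before [r0], times a factor
    [phi i] for every success in a later cell [i]. *)
Definition future_weight (z : seq (nat * bool)) : R :=
  (Q (past_trials z))%:R * \prod_(x <- z | (r0 <= x.1)%N && x.2) phi x.1.

(** Each further trial in cell [M] multiplies the weight by
    [theta * phi M + (number of preceding trials)], whence the rising
    factorial. *)
Lemma osum_future k M r z : (r0 <= M)%N ->
  osum k (nseq r M) (fun z' => future_weight (z ++ z')) =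
  future_weight z * rising_factorial (k%:R + theta * phi M) r.
Proof.
move=> rM; elim: r k z => [|r IHr] k z /=.
  by rewrite cats0 rising_factorial0 mulr1.
have E (b : bool) : future_weight (z ++ [:: (M, b)]) =
    future_weight z * (if b then phi M else 1).
  rewrite /future_weight /past_trials filter_cat /= ltnNge rM /= cats0 big_cat.
  by rewrite /= big_cons big_nil /= rM /= mulrA; case: b; rewrite ?mulr1.
have E' (b : bool) : osum k.+1 (nseq r M)
    (fun z' => future_weight (z ++ (M, b) :: z')) =
    future_weight z * (if b then phi M else 1) *
    rising_factorial (k.+1%:R + theta * phi M) r.
  by rewrite -E -IHr; apply: eq_osum => z' _; rewrite -catA.
rewrite !E' rising_factorial_recl.
by rewrite (_ : k%:R + theta * phi M + 1 = k.+1%:R + theta * phi M); ring.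
Qed.

Definition sorted_weight (c : seq nat) : R := osum 0 (sort leq c) future_weight.

Lemma sorted_weight_perm c c' : perm_eq c c' -> sorted_weight c = sorted_weight c'.
Proof.
move=> cc'; rewrite /sorted_weight; congr osum.
by apply/perm_sortP => //; [exact: leq_total|exact: leq_trans|exact: anti_leq].
Qed.

(** The trials in the largest cell come last in chronological order; this is the
    hypothesis of [wseries_peel]. *)
Lemma sorted_weight_peel M r c : (r0 <= M)%N ->
  all (fun i => i < M)%N c ->
  sorted_weight (nseq r M ++ c) =
  sorted_weight c * rising_factorial ((size c)%:R + theta * phi M) r.
Proof.
move=> rM cM; rewrite /sorted_weight.
have -> : sort leq (nseq r M ++ c) = sort leq c ++ nseq r M.
  apply: (@sorted_eq _ leq); [exact: leq_trans|exact: anti_leq| | |].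
  - exact: (sort_sorted leq_total).
  - rewrite sorted_pairwise; last exact: leq_trans.
    rewrite pairwise_cat -!sorted_pairwise; try exact: leq_trans.
    rewrite (sort_sorted leq_total) /=; apply/andP; split.
      apply/allrelP => i j; rewrite mem_sort => ic /nseqP[-> _].
      exact/ltnW/(allP cM).
    by elim: r => [//|[//|r] IHr] /=; rewrite leqnn; exact: IHr.
  - rewrite perm_sort perm_catC perm_cat2r perm_sym.
    by rewrite perm_sort.
rewrite osum_cat -osumZ; apply: eq_osum => z sz.
by rewrite osum_future// add0n size_sort.
Qed.

Hypothesis theta_ge0 : 0 <= theta.
Hypothesis phi_ge0 : forall i, 0 <= phi i.

Lemma future_weight_ge0 z : 0 <= future_weight z.
Proof. by rewrite mulr_ge0// prodr_ge0. Qed.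

Lemma sorted_weight_ge0 c : 0 <= sorted_weight c.
Proof. by apply: osum_ge0 => //; exact: future_weight_ge0. Qed.

Definition tail_mass (l : nat -> R) M i : R := \sum_(i <= j < M) l j.

(** Peeling the cells [r0 + m - 1, ..., r0] in turn.  After the cells from [i] on
    have been removed the argument is [q / (1 - q * L_i)], with [L_i] their total
    mass, so the constant factors are quotients of successive
    [1 - q * L_i]. *)
Lemma wseries_future (l : nat -> R) m (q : R) : (forall i, 0 <= l i) -> 0 <= q ->
  q * tail_mass l (r0 + m) r0 < 1 ->
  (wseries l q (r0 + m) sorted_weight =
  (\prod_(r0 <= i < r0 + m) ((1 - q * tail_mass l (r0 + m) i) /
     (1 - q * tail_mass l (r0 + m) i.+1)) `^ (- (theta * phi i)))%:E *
  wseries l (q / (1 - q * tail_mass l (r0 + m) r0)) r0 sorted_weight)%E.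
Proof.
move=> l0; elim: m q => [|m IHm] q q0.
  by rewrite addn0 /tail_mass !big_geq// mulr0 subr0 divr1 mul1e.
rewrite addnS; set M := (r0 + m)%N => qL1.
have tailS i : (i <= M)%N -> tail_mass l M.+1 i = tail_mass l M i + l M.
  by move=> iM; rewrite /tail_mass big_nat_recr.
have tail_ge0 i : 0 <= tail_mass l M i by apply: sumr_ge0.
have rM : (r0 <= M)%N by rewrite leq_addr.
have tail_le i : (r0 <= i)%N -> tail_mass l M i <= tail_mass l M r0.
  move=> ri; have [iM|/ltnW Mi] := leqP i M; last by rewrite {1}/tail_mass big_geq.
  rewrite /tail_mass (big_cat_nat ri iM) /= lerDr; exact: sumr_ge0.
rewrite tailS// mulrDr in qL1.
have ql1 : q * l M < 1.
  by apply: le_lt_trans qL1; rewrite lerDr mulr_ge0.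
have d0 : 0 < 1 - q * l M by rewrite subr_gt0.
rewrite (wseries_peel l0 sorted_weight_ge0 q0 ql1 (mulr_ge0 theta_ge0 (phi_ge0 M))
  sorted_weight_perm); last by move=> r c cM; exact: sorted_weight_peel.
set q' := q / (1 - q * l M).
have q'0 : 0 <= q' by rewrite divr_ge0// ltW.
have num i : 1 - q' * tail_mass l M i =
    (1 - q * (tail_mass l M i + l M)) / (1 - q * l M).
  by rewrite /q'; field; rewrite gt_eqF.
rewrite IHm//; last first.
  by rewrite /q' mulrAC ltr_pdivrMr// mul1r ltrBrDr.
rewrite muleA -EFinM; congr ((_)%:E * _)%E; last first.
  rewrite num tailS//; congr (wseries _ _ _ _).
  have d1 : 0 < 1 - q * (tail_mass l M r0 + l M) by rewrite mulrDr subr_gt0.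
  by rewrite /q'; field; rewrite !gt_eqF.
rewrite big_nat_recr //= mulrC; congr (_ * _); last first.
  rewrite tailS// {1}/tail_mass [\sum_(M <= _ < M) _]big_geq// add0r.
  by rewrite /tail_mass big_geq// mulr0 subr0 divr1.
apply: eq_big_nat => i /andP[ri iM]; rewrite tailS 1?ltnW// tailS// !num.
have d1 : 0 < 1 - q * (tail_mass l M i.+1 + l M).
  rewrite mulrDr subr_gt0; apply: le_lt_trans qL1.
  by rewrite lerD2r ler_wpM2l// tail_le// leqW.
by congr (_ `^ _); field; rewrite !gt_eqF.
Qed.

End EwensOutcomes.

(** * Cells of a grid, and measurability of the trials *)
Section Cells.
Variable R : realType.
Implicit Types (S : seq R) (x y s : R).

(** For a sorted grid the cells are the half-open intervals, closed on the right,
    between consecutive grid points. *)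
Definition cell S x : nat := count (fun s => s < x) S.

Lemma cell_homo S : {homo cell S : x y / x <= y >-> (x <= y)%N}.
Proof. by move=> x y xy; apply: sub_count => s /= sx; exact: lt_le_trans xy. Qed.

Lemma cell_lt S x : (cell S x < (size S).+1)%N.
Proof. by rewrite ltnS count_size. Qed.

Lemma eq_count_sub (T : eqType) (a b : pred T) (l : seq T) :
  subpred a b -> count a l = count b l -> {in l, a =1 b}.
Proof.
move=> ab; elim: l => [//|x l IHl] /=.
have h := sub_count ab l.
case: (boolP (a x)) => [ax|nax]; rewrite ?(ab _ ax) /=.
  move=> [] /IHl H y; rewrite inE => /predU1P[->|/H//].
  by rewrite ax (ab _ ax).
case: (boolP (b x)) => [bx|nbx]; rewrite ?add0n /= => e.
  by move: h; rewrite e add1n ltnn.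
by move=> y; rewrite inE => /predU1P[->|/(IHl e)//]; rewrite (negPf nax) (negPf nbx).
Qed.

Lemma cell_eq S x y : cell S x = cell S y -> {in S, forall s, (x <= s) = (y <= s)}.
Proof.
wlog xy : x y / x <= y.
  move=> h; have [|/ltW] := leP x y; first exact: h.
  by move=> yx e s sS; rewrite (h y x).
move=> e s sS; have := eq_count_sub _ e sS => /(_ _)/= H.
by rewrite !leNgt H// => z zx; exact: lt_le_trans xy.
Qed.

Lemma cell_geP x0 S x i : sorted <=%O S -> (i < size S)%N ->
  (i < cell S x)%N = (nth x0 S i < x).
Proof.
move=> sS iS; apply/idP/idP => [|h]; first exact: nth_count_lt.
rewrite ltnNge; apply/negP => ci; move: h; rewrite ltNge => /negP; apply.
by apply: nth_count_ge => //; rewrite iS andbT.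
Qed.

Lemma measurable_cell S i : measurable [set x | cell S x = i].
Proof.
have mS : measurable_fun setT (cell S).
  elim: S => [|s S IHS]; first exact: measurable_cst.
  rewrite /cell /=; apply: measurable_fun_addn => //.
  apply: (measurableT_comp (f := nat_of_bool)) => //.
  exact: measurable_fun_ltr.
by have := mS measurableT [set i]; rewrite setTI; apply.
Qed.
End Cells.

Section Epochs.
Context d (T : measurableType d) (R : realType) (P : probability T R).
Variables (N : {RV P >-> nat}) (U : nat -> {RV P >-> R}) (B : nat -> {RV P >-> bool}).
Implicit Types (S : seq R).

(** The order statistics enter the measurability proofs only through the numbers
    of variables below given levels. *)
Lemma epoch_le k w s : (k < N w)%N ->
  (epoch N U k w <= s) = (k < count (fun i => U i w <= s)%R (iota 0 (N w)))%N.
Proof.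
move=> kN; rewrite /epoch; set l := [seq U i w | i <- _].
have -> : count (fun i => U i w <= s)%R (iota 0 (N w)) = count (<= s) (sort <=%O l).
  by rewrite (permP (permEl (perm_sort _ l))) /l count_map.
have ss : sorted <=%O (sort <=%O l) by exact: sort_le_sorted.
apply/idP/idP => [h|]; last exact: nth_count_le.
rewrite ltnNge; apply/negP => ci; move: h; rewrite leNgt => /negP; apply.
apply: nth_count_gt => //; rewrite ci /= size_sort size_map size_iota//.
Qed.

Lemma epoch_homo j k w : (j <= k < N w)%N -> epoch N U j w <= epoch N U k w.
Proof.
move=> /andP[jk kN]; rewrite epoch_le; last exact: leq_ltn_trans kN.
by apply: (leq_ltn_trans jk); rewrite -epoch_le.
Qed.

Lemma measurable_number n : measurable [set w | N w = n].
Proof.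
by have := measurable_funP N measurableT [set n]; rewrite setTI; apply.
Qed.

(** A quantity that depends on a random number of variables is measurable as soon
    as it is for each fixed number. *)
Lemma measurable_number_partition d' (T' : measurableType d') (f : T -> T') :
  (forall n, exists2 g, measurable_fun setT g & forall w, N w = n -> f w = g w) ->
  measurable_fun setT f.
Proof.
move=> fg _ Y mY; rewrite setTI.
have -> : f @^-1` Y = \bigcup_n ([set w | N w = n] `&` f @^-1` Y).
  by apply/seteqP; split => [w fw|w [n _ []]//]; exists (N w).
apply: bigcup_measurable => n _; have [g mg fg'] := fg n.
have -> : [set w | N w = n] `&` f @^-1` Y = [set w | N w = n] `&` g @^-1` Y.
  by apply/seteqP; split => w [/= wn]; rewrite /preimage /= fg'.
apply: measurableI; first exact: measurable_number.
by rewrite -[_ @^-1` _]setTI; exact: mg.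
Qed.

Lemma measurable_count_le (l : seq nat) s :
  measurable_fun setT (fun w => count (fun i => U i w <= s)%R l).
Proof.
elim: l => [|i l IHl] /=; first exact: measurable_cst.
apply: measurable_fun_addn => //.
apply: (measurableT_comp (f := nat_of_bool)) => //.
exact: measurable_fun_ler.
Qed.

Lemma measurable_epoch k : measurable_fun setT (epoch N U k).
Proof.
apply: (measurability _ (RGenOInfty.measurableE R)) => //.
move=> _ [_ [s ->] <-]; rewrite setTI.
have -> : epoch N U k @^-1` `]s, +oo[ = ~` [set w | epoch N U k w <= s].
  apply/seteqP; split => w /=; rewrite in_itv /= andbT ltNge.
    by move/negP.
  by move=> /negP.
apply: measurableC.
have -> : [set w | epoch N U k w <= s] =
    (fun w => if (k < N w)%N then (k < count (fun i => U i w <= s)%R (iota 0 (N w)))%N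
              else (0 <= s)%R) @^-1` [set true].
  have E w : (k < N w)%N = false -> epoch N U k w = 0.
    by move=> kN; rewrite /epoch nth_default// size_sort size_map size_iota leqNgt kN.
  apply/seteqP; split => w /=; (case: (boolP (k < N w)%N) => kN; first by rewrite epoch_le).
    by rewrite E//; exact: negbTE.
  by rewrite E//; exact: negbTE.
rewrite -[X in measurable X]setTI; apply: measurable_number_partition => // n.
exists (if (k < n)%N then fun w => (k < count (fun i => U i w <= s)%R (iota 0 n))%N
        else fun=> (0 <= s)%R); last by move=> w ->; case: ifP.
case: ifP => _; last exact: measurable_cst.
by apply: measurable_fun_ltn; [exact: measurable_cst|exact: measurable_count_le].
Qed.

Definition trials S w : seq (nat * bool) :=
  [seq (cell S (epoch N U k w), B k w) | k <- iota 0 (N w)].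

Lemma size_trials S w : size (trials S w) = N w.
Proof. by rewrite size_map size_iota. Qed.

Lemma nth_trials x0 S w k : (k < N w)%N ->
  nth x0 (trials S w) k = (cell S (epoch N U k w), B k w).
Proof. by move=> kN; rewrite (nth_map 0%N) ?size_iota// nth_iota. Qed.

(** Sorting the variables before or after passing to cells gives the same list of
    cells, as [cell] is monotone: the word of cells of the unsorted variables,
    whose law is a product, determines everything. *)
Lemma trials_zip S w : trials S w =
  zip (sort leq [seq cell S (U i w) | i <- iota 0 (N w)]) [seq B k w | k <- iota 0 (N w)].
Proof.
have sz : size (sort leq [seq cell S (U i w) | i <- iota 0 (N w)]) = N w.
  by rewrite size_sort size_map size_iota.
have szB : size [seq B k w | k <- iota 0 (N w)] = N w by rewrite size_map size_iota.
apply: (@eq_from_nth _ (0%N, false)).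
  by rewrite size_trials size_zip sz szB minnn.
move=> k; rewrite size_trials => kN; rewrite nth_trials// nth_zip ?sz ?szB//.
rewrite (nth_map 0%N) ?size_iota// nth_iota// add0n; congr pair.
have -> : sort leq [seq cell S (U i w) | i <- iota 0 (N w)] =
    [seq cell S x | x <- sort <=%O [seq U i w | i <- iota 0 (N w)]].
  apply: (@sorted_eq _ leq); [exact: leq_trans|exact: anti_leq| | |].
  - exact: (sort_sorted leq_total).
  - by apply: homo_sorted (@cell_homo _ S) _ _; exact: sort_le_sorted.
  - rewrite perm_sort (map_comp (cell S) (fun i => U i w)) perm_map// perm_sym.
    by rewrite perm_sort.
by rewrite (nth_map 0) ?size_sort ?size_map ?size_iota.
Qed.

Lemma measurable_trials S (V : set (seq (nat * bool))) :
  measurable [set w | V (trials S w)].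
Proof.
have -> : [set w | V (trials S w)] = \bigcup_n
    [set w | exists2 z, unpickle n = Some z & V z /\ trials S w = z].
  apply/seteqP; split => [w Vw|w [n _ [z _ [Vz e]]]]; last by rewrite /= e.
  by exists (pickle (trials S w)) => //; exists (trials S w); rewrite ?pickleK.
apply: bigcup_measurable => n _.
case E : (unpickle n) => [z|]; last first.
  by rewrite (_ : [set _ | _] = set0)//; apply/seteqP; split => // w [].
have [Vz|nVz] := pselect (V z); last first.
  by rewrite (_ : [set _ | _] = set0)//; apply/seteqP; split => // w [_ [<-] []].
have -> : [set w | exists2 z0, Some z = Some z0 & V z0 /\ trials S w = z0] =
    [set w | N w = size z] `&` \bigcap_(k in [set k | (k < size z)%N])
      ([set w | cell S (epoch N U k w) = (nth (0%N, false) z k).1] `&`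
       [set w | B k w = (nth (0%N, false) z k).2]).
  apply/seteqP; split => w.
    move=> [_ [<-] [_ e]]; split; first by rewrite /= -e size_trials.
    by move=> k /= kz; rewrite -e nth_trials// -(size_trials S) e.
  move=> [/= Nz h]; exists z => //; split => //.
  apply: (@eq_from_nth _ (0%N, false)) => [|k]; rewrite size_trials// => kN.
  rewrite nth_trials// [RHS]surjective_pairing.
  have kz : (k < size z)%N by rewrite -Nz.
  by have [/= -> ->] := h k kz.
apply: measurableI; first exact: measurable_number.
apply: bigcap_measurableType => k _; apply: measurableI.
  rewrite -[X in measurable X]setTI.
  exact: (measurable_epoch k measurableT (measurable_cell S _)).
rewrite -[X in measurable X]setTI.
by have := measurable_funP (B k) measurableT [set (nth (0%N, false) z k).2]; apply.
Qed.

Lemma measurable_trials_fun S d' (T' : measurableType d') (f : seq (nat * bool) -> T') :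
  measurable_fun setT (f \o trials S).
Proof. by move=> _ Y mY; rewrite setTI; exact: (measurable_trials S (f @^-1` Y)). Qed.

(** The expectations of these products form the generating functional of the
    point process of success epochs. *)
Definition success_prod (f : R -> R) w : R :=
  \prod_(t <- success_epochs N U B w) f t.

Lemma success_prodE f w :
  success_prod f w = \prod_(k < N w | B k w) f (epoch N U k w).
Proof.
rewrite /success_prod /success_epochs big_map big_filter.
by rewrite -[X in iota _ X]subn0 big_mkord.
Qed.

Lemma measurable_success_prod f : measurable_fun setT f ->
  measurable_fun setT (success_prod f).
Proof.
move=> mf; apply: measurable_number_partition => n.
exists (fun w => \prod_(k < n) (if B k w then f (epoch N U k w) else 1)).
  apply: measurable_prod => k _.
  apply: (@measurable_fun_ifT _ _ _ _ (f \o epoch N U k) (cst 1) (B k)) => //.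
  exact: measurableT_comp (measurable_epoch k).
by move=> w <-; rewrite success_prodE big_mkcond.
Qed.

Lemma measurable_success_count A : measurable A ->
  measurable_fun setT (success_count N U B A).
Proof.
move=> mA; apply: measurable_number_partition => n.
exists (fun w => \sum_(k < n) (B k w && (epoch N U k w \in A)))%N; last first.
  move=> w Nw; rewrite /success_count /success_epochs Nw count_map -size_filter.
  rewrite -filter_predI size_filter -sum1_count big_mkcond /=.
  rewrite -[X in iota _ X]subn0 big_mkord; apply: eq_bigr => k _.
  by rewrite andbC; case: ifP.
elim: n => [|n IHn].
  by under eq_fun do rewrite big_ord0; exact: measurable_cst.
under eq_fun do rewrite big_ord_recr /=; apply: measurable_fun_addn => //.
apply: (measurableT_comp (f := nat_of_bool)) => //.
apply: measurable_and => //.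
apply: (measurable_fun_bool true); rewrite setTI.
have -> : (fun w => epoch N U n w \in A) @^-1` [set true] = epoch N U n @^-1` A.
  by apply/seteqP; split => w /=; [exact: set_mem|exact: mem_set].
by rewrite -[X in measurable X]setTI; exact: measurable_epoch.
Qed.
End Epochs.

(** * The law of the trials as a generating function *)
Lemma big_tuple_cons (R : nmodType) (I : finType) n (G : seq I -> R) :
  \sum_(t : n.+1.-tuple I) G t = \sum_(i : I) \sum_(t : n.-tuple I) G (i :: t).
Proof.
rewrite pair_big /= (reindex (fun p : I * n.-tuple I => [tuple of p.1 :: p.2])) /=.
  by apply: eq_bigr.
exists (fun t : n.+1.-tuple I => (thead t, [tuple of behead t])) => [[i t] _|t _] /=.
  by rewrite theadE; congr pair; exact: val_inj.
by rewrite [RHS]tuple_eta.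
Qed.

(** The recursive sums [wsum] and [osum] as sums over finite types, the form in
    which they arise when the sample space is split into atoms. *)
Lemma wsum_tuple (R : realType) (l : nat -> R) M n (F : seq nat -> R) :
  wsum l M n F =
  \sum_(c : n.-tuple 'I_M) (\prod_(i <- c) l i) * F [seq val i | i <- c].
Proof.
elim: n F => [|n IHn] F.
  rewrite (bigD1 [tuple]) //= big_nil mul1r big1 ?addr0// => t /eqP; case.
  by rewrite [t]tuple0.
rewrite (big_tuple_cons _ (fun c : seq 'I_M => (\prod_(i <- c) l i) * F [seq val i | i <- c])) /=.
apply: eq_bigr => i _; rewrite IHn mulr_sumr; apply: eq_bigr => t _.
by rewrite big_cons mulrA.
Qed.

Fixpoint outcome_weight (R : realType) (theta : R) k (b : seq bool) : R :=
  if b is x :: b' then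
    (if x then theta else k%:R) * outcome_weight theta k.+1 b'
  else 1.

Lemma osum_tuple (R : realType) (theta : R) k n (s : seq nat)
    (F : seq (nat * bool) -> R) : size s = n ->
  osum theta k s F =
  \sum_(b : n.-tuple bool) outcome_weight theta k b * F (zip s b).
Proof.
move=> <-; elim: s k F => [|i s IHs] k F.
  rewrite (bigD1 [tuple]) //= mul1r big1 ?addr0// => t /eqP; case.
  by rewrite [t]tuple0.
rewrite (big_tuple_cons _ (fun b => outcome_weight theta k b * F (zip (i :: s) b))) /=.
rewrite big_bool /= !IHs !mulr_sumr; congr (_ + _);
by apply: eq_bigr => t _; rewrite mulrA.
Qed.

(** The denominators [theta + j] multiply up to the rising factorial which the
    negative binomial law cancels. *)
Lemma outcome_weight_prod (R : realType) (theta : R) k (b : seq bool) :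
  0 < theta ->
  \prod_(j < size b) (if nth false b j then theta / (theta + (k + j)%:R)
                      else (k + j)%:R / (theta + (k + j)%:R)) =
  outcome_weight theta k b / rising_factorial (theta + k%:R) (size b).
Proof.
move=> t0; elim: b k => [|x b IHb] k.
  by rewrite big_ord0 rising_factorial0 divr1.
rewrite [LHS]big_ord_recl /= addn0 rising_factorial_recl.
rewrite (_ : theta + k%:R + 1 = theta + k.+1%:R); last by ring.
under eq_bigr do rewrite /bump leq0n add1n /= addnS -addSn.
rewrite IHb; set r := rising_factorial _ _.
have r0 : r != 0 by rewrite gt_eqF// prodr_gt0// => j _; rewrite !ltr_wpDr.
have t1 : theta + k%:R != 0 by rewrite gt_eqF// ltr_wpDr.
by case: x; field; rewrite t1 r0.
Qed.

Section TrialsLaw.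
Context d (T : measurableType d) (R : realType) (P : probability T R).
Variables (theta q : R).
Variables (N : {RV P >-> nat}) (U : nat -> {RV P >-> R}) (B : nat -> {RV P >-> bool}).
Hypothesis theta_gt0 : 0 < theta.
Hypothesis q01 : 0 < q < 1.
Hypothesis model : trials_model (negative_binomial_pmf theta q)
               (fun k => theta / (theta + k%:R - 1)) N U B.
Variable S : seq R.

Definition cell_mass i : R := fine (uniform_prob (@ltr01 R) [set x | cell S x = i]).

Lemma cell_massE j i : P [set w | cell S (U j w) = i] = (cell_mass i)%:E.
Proof.
rewrite /cell_mass fineK; last first.
  rewrite fin_num_measure//; exact: measurable_cell.
have := uniform_law model j (measurable_cell S i); exact.
Qed.

Lemma success_prob k (b : bool) : P [set w | B k w = b] =
  (if b then theta / (theta + k%:R) else k%:R / (theta + k%:R))%:E.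
Proof.
have h := success_law model k.
have e : theta + k.+1%:R - 1 = theta + k%:R by rewrite -natr1; ring.
have mB : measurable [set w | B k w].
  by have := measurable_funP (B k) measurableT [set true]; rewrite setTI; apply.
rewrite e in h; case: b => //.
have -> : [set w | B k w = false] = ~` [set w | B k w].
  by apply/seteqP; split => w /=; [move=> ->|move/negP/negbTE].
rewrite probability_setC// h -EFinB; congr EFin; field.
by rewrite gt_eqF// ltr_wpDr.
Qed.

(** On an atom the list of trials is constant; the word [c] lists the cells of
    the variables before sorting. *)
Definition atom n (c : seq nat) (b : seq bool) : set T :=
  [set w | [/\ N w = n, [seq cell S (U i w) | i <- iota 0 n] = c &
               [seq B k w | k <- iota 0 n] = b]].

Lemma atom_prob n c b : size c = n -> size b = n ->
  P (atom n c b) = (negative_binomial_pmf theta q n * (\prod_(i <- c) cell_mass i) *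
    (outcome_weight theta 0 b / rising_factorial theta n))%:E /\
  measurable (atom n c b).
Proof.
move=> sc sb.
pose A (i : option (nat + nat)) : set T := match i with
  | None => [set w | N w = n]
  | Some (inl j) => [set w | cell S (U j w) = nth 0%N c j]
  | Some (inr k) => [set w | B k w = nth false b k] end.
pose s := None :: [seq Some (inl j) | j <- iota 0 n] ++
                  [seq Some (inr j : nat + nat) | j <- iota 0 n].
have mA i : measurable (A i).
  case: i => [[j|k]|] /=.
  - by rewrite -[X in measurable X]setTI; have := measurable_funP (U j) measurableT _ (measurable_cell S (nth 0%N c j)); apply.
  - rewrite -[X in measurable X]setTI.
    by have := measurable_funP (B k) measurableT [set nth false b k]; apply.
  - exact: measurable_number.
have As : atom n c b = \bigcap_(i in [set` s]) A i.
  apply/seteqP; split => w.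
    move=> [Nw cw bw] i /=; rewrite inE => /predU1P[->//|].
    rewrite mem_cat => /orP[] /mapP[j]; rewrite mem_iota add0n => /= jn -> /=.
      by rewrite -cw (nth_map 0%N) ?size_iota// nth_iota.
    by rewrite -bw (nth_map 0%N) ?size_iota// nth_iota.
  move=> h; split.
  - by have := h None; apply; rewrite /= inE eqxx.
  - apply: (@eq_from_nth _ 0%N); rewrite size_map size_iota// => j jn.
    rewrite (nth_map 0%N) ?size_iota// nth_iota//.
    have := h (Some (inl j)); apply; rewrite /= inE /= mem_cat; apply/orP; left.
    by apply/mapP; exists j => //; rewrite mem_iota.
  - apply: (@eq_from_nth _ false); rewrite size_map size_iota// => j jn.
    rewrite (nth_map 0%N) ?size_iota// nth_iota//.
    have := h (Some (inr j)); apply; rewrite /= inE /= mem_cat; apply/orP; right.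
    by apply/mapP; exists j => //; rewrite mem_iota.
split; last by rewrite As; apply: fin_bigcap_measurable.
rewrite As (trials_independent model); first last.
- case=> [[j|k]|] _ /=.
  + by exists [set x | cell S x = nth 0%N c j]; [exact: measurable_cell|rewrite setTI].
  + by exists [set nth false b k] => //; rewrite setTI.
  + by exists [set n] => //; rewrite setTI.
- rewrite /= cat_uniq !map_inj_uniq ?iota_uniq/=; try by move=> x y [].
  rewrite andbT mem_cat negb_or; apply/andP; split.
    by apply/andP; split; apply/negP => /mapP[].
  by apply/hasPn => x /mapP[j _ ->]; apply/negP => /mapP[].
rewrite big_cons big_cat !big_map /= (number_law model).
under eq_bigr do rewrite cell_massE.
under [X in (_ * (_ * X))%E]eq_bigr do rewrite success_prob.
rewrite !prodEFin -!EFinM; congr EFin; rewrite mulrA; congr (_ * _ * _).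
  by rewrite [RHS](big_nth 0%N) sc /index_iota subn0.
have := outcome_weight_prod 0 b theta_gt0; rewrite addr0 sb => <-.
by rewrite -[X in iota _ X]subn0 -/(index_iota 0 n) big_mkord.
Qed.

(** The rising factorial [(theta)_n] of the law of [N] and the denominator of the
    outcome probabilities cancel here: the shape parameter has to be the [theta]
    of the success probabilities. *)
Lemma integral_trials_number n (F : seq (nat * bool) -> R) : (forall z, 0 <= F z) ->
  (\int[P]_(w in [set w | N w = n]) (F (trials N U B S w))%:E =
   ((1 - q) `^ theta * (q ^+ n / n`!%:R *
     wsum cell_mass (size S).+1 n (fun c => osum theta 0 (sort leq c) F)))%:E)%E.
Proof.
move=> F0; pose I := (n.-tuple 'I_(size S).+1 * n.-tuple bool)%type.
pose cw (p : I) := [seq val i | i <- p.1].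
pose D (p : I) := atom n (cw p) p.2.
have scw p : size (cw p) = n by rewrite size_map size_tuple.
have DE : [set w | N w = n] = \big[setU/set0]_(p <- index_enum I) D p.
  rewrite -bigcup_seq; apply/seteqP; split => w; last by move=> [p _ []].
  move=> /= Nw.
  pose c := [tuple (inord (cell S (U i w)) : 'I_(size S).+1) | i < n].
  exists (c, [tuple B i w | i < n]); first by rewrite /= mem_index_enum.
  split => //=.
    rewrite /cw /= -map_comp -val_enum_ord -map_comp; apply: eq_map => i /=.
    by rewrite inordK// cell_lt.
  by rewrite -val_enum_ord -map_comp.
have mD p : measurable (D p).
  by have [] := atom_prob (scw p) (size_tuple p.2).
rewrite DE ge0_integral_bigsetU//=; last 4 first.
- exact: index_enum_uniq.
- move=> p p' _ _ [w [[_ h1 h2] [_ h3 h4]]]; apply: injective_projections.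
    by apply/val_inj/(inj_map val_inj); rewrite -/(cw p) -h1 h3.
  by apply: val_inj; rewrite /= -h2 h4.
- apply/measurable_EFinP; apply: (measurable_funS measurableT) => //.
  exact: (measurable_trials_fun N U B S F).
- by move=> w _; rewrite lee_fin.
have H p : (\int[P]_(w in D p) (F (trials N U B S w))%:E =
   (F (zip (sort leq (cw p)) p.2) * (negative_binomial_pmf theta q n *
     (\prod_(i <- cw p) cell_mass i) *
    (outcome_weight theta 0 p.2 / rising_factorial theta n)))%:E)%E.
  have [Pp _] := atom_prob (scw p) (size_tuple p.2).
  rewrite EFinM -Pp -/(D p) -integral_cst//; apply: eq_integral => w; rewrite inE.
  by move=> [Nw cw' bw]; rewrite trials_zip Nw cw' bw.
under eq_bigr do rewrite H.
rewrite sumEFin; congr EFin.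
rewrite wsum_tuple !mulr_sumr -(pair_bigA _ (fun (c : n.-tuple 'I_(size S).+1) (b : n.-tuple bool) =>
  F (zip (sort leq [seq val i | i <- tval c]) b) * (negative_binomial_pmf theta q n *
     (\prod_(i <- [seq val i | i <- tval c]) cell_mass i) *
    (outcome_weight theta 0 b / rising_factorial theta n)))) /=.
apply: eq_bigr => c _; rewrite (@osum_tuple _ _ _ n) ?size_sort ?size_map ?size_tuple//.
rewrite !mulr_sumr; apply: eq_bigr => b _; rewrite big_map /negative_binomial_pmf.
have r0 : rising_factorial theta n != 0.
  by rewrite gt_eqF// prodr_gt0// => j _; rewrite ltr_wpDr.
have n0 : n`!%:R != 0 :> R by rewrite pnatr_eq0 -lt0n fact_gt0.
by field; rewrite r0 n0.
Qed.

Lemma expectation_trials (F : seq (nat * bool) -> R) : (forall z, 0 <= F z) ->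
  (\int[P]_w (F (trials N U B S w))%:E = ((1 - q) `^ theta)%:E *
     wseries cell_mass q (size S).+1 (fun c => osum theta 0 (sort leq c) F))%E.
Proof.
move=> F0; have -> : [set: T] = \bigcup_n [set w | N w = n].
  by apply/seteqP; split => // w _; exists (N w).
rewrite ge0_integral_bigcup//.
- rewrite /wseries -nneseriesZl; last first.
    move=> n _; rewrite lee_fin mulr_ge0// ?divr_ge0 ?exprn_ge0//.
      by have /andP[/ltW] := q01.
    apply: wsum_ge0 => [i|c]; first exact: fine_ge0.
    by apply: osum_ge0 => //; exact: ltW.
  by apply: eq_eseriesr => n _; rewrite integral_trials_number// EFinM.
- by move=> k; exact: measurable_number.
- apply/measurable_EFinP; apply: (measurable_funS measurableT) => //.
  exact: (measurable_trials_fun N U B S F).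
- by move=> w _; rewrite lee_fin.
- by move=> i j _ _ [w [/= <- <-]].
Qed.
End TrialsLaw.

(** * The identity for step functions *)
Section Hazard.
Variables (R : realType) (theta q : R).
Hypothesis theta_gt0 : 0 < theta.
Hypothesis q01 : 0 < q < 1.

Definition clip (x : R) : R := Num.max 0 (Num.min x 1).

Lemma clip_01 x : 0 <= clip x <= 1.
Proof. by rewrite /clip le_max lexx ge_max ler01 ge_min lexx orbT. Qed.

Lemma clip_id x : 0 <= x <= 1 -> clip x = x.
Proof. by move=> /andP[x0 x1]; rewrite /clip min_l// max_r. Qed.

Lemma clip_lt0 x : x <= 0 -> clip x = 0.
Proof. by move=> x0; rewrite /clip max_l// ge_min x0. Qed.

Lemma clip_gt1 x : 1 <= x -> clip x = 1.
Proof. by move=> x1; rewrite /clip min_r// max_r. Qed.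

(** The integral of the rate over the part of the unit interval beyond [x], in
    closed form; see [integral_rate_gt]. *)
Definition hazard (x : R) : R := - theta * ln (1 - q * (1 - clip x)).

Lemma uniform_prob_gt x : uniform_prob (@ltr01 R) `]x, +oo[ = (1 - clip x)%:E.
Proof.
rewrite /uniform_prob integral_uniform_pdf.
have E (A : set R) : measurable A -> A `<=` `[0, 1] ->
    (\int[lebesgue_measure]_(y in A) (uniform_pdf 0 1 y)%:E = lebesgue_measure A)%E.
  move=> mA A01; rewrite -[RHS]mul1e -integral_cst//; apply: eq_integral => y.
  by rewrite inE => /A01 /=; rewrite in_itv /= /uniform_pdf => ->; rewrite subr0 invr1.
have [x0|x0] := ltP x 0.
  rewrite (_ : _ `&` _ = `[0, 1]%classic); last first.
    apply/seteqP; split => y /=; rewrite !in_itv /= ?andbT; first by case.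
    by move=> /andP[y0 y1]; split; rewrite ?y0//; exact: lt_le_trans y0.
  by rewrite E// lebesgue_measure_itv /= lte_fin ltr01 clip_lt0 ?ltW// -EFinB.
have [x1|x1] := ltP 1 x.
  rewrite (_ : _ `&` _ = set0); last first.
    apply/seteqP; split => y //=; rewrite !in_itv /= ?andbT => -[xy /andP[_ y1]].
    by move: (lt_trans x1 xy); rewrite ltNge y1.
  by rewrite integral_set0 clip_gt1 ?subrr// ltW.
rewrite (_ : _ `&` _ = `]x, 1]%classic); last first.
  apply/seteqP; split => y /=; rewrite !in_itv /= ?andbT.
    by move=> [-> /andP[_ ->]].
  move=> /andP[xy ->]; rewrite xy andbT; split => //.
  by apply: le_trans x0 (ltW xy).
rewrite E//; last first.
  move=> y /=; rewrite !in_itv /= => /andP[xy ->]; rewrite andbT.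
  by apply: le_trans x0 (ltW xy).
rewrite lebesgue_measure_itv /= lte_fin clip_id ?x0//.
case: ltP => [_|h]; first by rewrite -EFinB.
by rewrite (@le_anti _ _ x 1) ?subrr// x1 h.
Qed.

Lemma hazard_arg_gt0 x : 0 < 1 - q * (1 - clip x).
Proof.
have /andP[c0 c1] := clip_01 x; have /andP[q0 q1] := q01.
by rewrite subr_gt0; apply: le_lt_trans q1; rewrite ler_piMr ?(ltW q0)// lerBlDr lerDl.
Qed.

End Hazard.

Section Master.
Context d (T : measurableType d) (R : realType) (P : probability T R).
Variables (theta q : R).
Variables (N : {RV P >-> nat}) (U : nat -> {RV P >-> R}) (B : nat -> {RV P >-> bool}).
Hypothesis theta_gt0 : 0 < theta.
Hypothesis q01 : 0 < q < 1.
Hypothesis model : trials_model (negative_binomial_pmf theta q)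
               (fun k => theta / (theta + k%:R - 1)) N U B.
Variable S : seq R.
Hypothesis sortedS : sorted <=%O S.

(** Cell [i] is the interval from [bd i] (excluded) to [bd i.+1] (included); the
    values [-1] and [2] stand for infinite ends, as the epochs are in [0, 1]. *)
Definition bd i : R := nth 2 (-1 :: S) i.

Lemma cell_ge_setE i : (i <= size S)%N ->
  uniform_prob (@ltr01 R) [set x | (i <= cell S x)%N] = (1 - clip (bd i))%:E.
Proof.
case: i => [_|i iS].
  have -> : [set x : R | (0 <= cell S x)%N] = setT by apply/seteqP; split.
  by rewrite probability_setT /bd /= clip_lt0 ?subr0// lerN10.
rewrite -uniform_prob_gt; congr uniform_prob; apply/seteqP; split => x /=;
by rewrite in_itv /= andbT (cell_geP 2).
Qed.

Lemma cell_mass_diff i : (i <= size S)%N ->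
  cell_mass S i = clip (bd i.+1) - clip (bd i).
Proof.
move=> iS; rewrite /cell_mass.
have mge j : measurable [set x | (j <= cell S x)%N].
  have -> : [set x | (j <= cell S x)%N] =
      \bigcup_(k in [set k | (j <= k)%N]) [set x | cell S x = k].
    apply/seteqP; split => x /=; first by move=> jx; exists (cell S x).
    by move=> [k /= jk ->].
  by apply: bigcup_measurable => k _; exact: measurable_cell.
have -> : [set x | cell S x = i] = [set x | (i <= cell S x)%N] `\`
    [set x | (i.+1 <= cell S x)%N].
  apply/seteqP; split => x /=; first by move=> ->; rewrite leqnn ltnn.
  by move=> [ix /negP]; rewrite -leqNgt => xi; apply/eqP; rewrite eqn_leq ix xi.
set A := [set x | (i <= cell S x)%N]; set A' := [set x | (i.+1 <= cell S x)%N].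
have mA : measurable A := mge i; have mA' : measurable A' := mge i.+1.
have -> : uniform_prob (@ltr01 R) (A `\` A') =
    (uniform_prob (@ltr01 R) A - uniform_prob (@ltr01 R) (A `&` A'))%E.
  apply: measureD => //; have := ltry (1 - clip (bd i)).
  by rewrite -(cell_ge_setE iS).
rewrite setIidr; last by move=> x /=; exact: ltnW.
rewrite cell_ge_setE//; have [iS'|] := ltnP i (size S).
  by rewrite cell_ge_setE//=; ring.
move=> Si; have {}Si : i = size S by apply/eqP; rewrite eqn_leq iS.
have -> : A' = set0.
  by apply/seteqP; split => x //=; rewrite /A' /= Si ltnNge count_size.
by rewrite measure0 sube0 /= {2}/bd /= nth_default ?Si// (@clip_gt1 R 2) ?ler1n.
Qed.

Lemma cell_tail i : (i <= (size S).+1)%N ->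
  tail_mass (@cell_mass R S) (size S).+1 i = 1 - clip (bd i).
Proof.
move=> iS; rewrite /tail_mass.
rewrite (eq_big_nat _ _ (F2 := fun j => clip (bd j.+1) - clip (bd j))); last first.
  by move=> j /andP[_ jS]; rewrite cell_mass_diff.
rewrite telescope_sumr//; congr (_ - _).
by rewrite /bd /= nth_default// (@clip_gt1 R 2) ?ler1n.
Qed.

Lemma cell_mass_ge0 i : 0 <= cell_mass S i.
Proof. exact: fine_ge0. Qed.

(** The quotients in [wseries_future] are exponentials of hazard increments.  In
    the series that remains only letters below [r0] occur, so [phi] may be
    replaced there by 1. *)
Lemma expectation_future r0 (phi : nat -> R) (Q : seq (nat * bool) -> bool) :
  (r0 <= (size S).+1)%N -> (forall i, 0 <= phi i) ->
  (\int[P]_w (future_weight r0 phi Q (trials N U B S w))%:E =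
   (expR (\sum_(r0 <= i < (size S).+1)
      phi i * (hazard theta q (bd i) - hazard theta q (bd i.+1))))%:E *
   (((1 - q) `^ theta)%:E *
    wseries (cell_mass S) (q / (1 - q * (1 - clip (bd r0)))) r0
      (sorted_weight theta r0 (fun=> 1%R) Q)))%E.
Proof.
move=> rS phi0; have t0 := ltW theta_gt0.
have /andP[q0 q1] := q01.
rewrite (expectation_trials theta_gt0 q01 model S (@future_weight_ge0 _ r0 phi Q phi0)).
rewrite -/(sorted_weight theta r0 phi Q); have e := subnKC rS.
rewrite -{1}e (@wseries_future _ theta r0 phi Q t0 phi0 _ _ q cell_mass_ge0 (ltW q0)); last first.
  by rewrite e cell_tail// -subr_gt0 hazard_arg_gt0.
rewrite e cell_tail// muleCA; congr ((_)%:E * _)%E.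
  rewrite expR_sum; apply: eq_big_nat => i /andP[_ iS].
  rewrite cell_tail 1?ltnW// cell_tail// /powR gt_eqF; last first.
    by rewrite divr_gt0 ?hazard_arg_gt0.
  congr expR; rewrite /hazard ln_div ?posrE ?hazard_arg_gt0//; ring.
congr (_ * _)%E; apply: eq_eseriesr => n _; congr (_ * _)%:E.
apply: eq_wsum => c _ cr; apply: eq_osum => z zc.
rewrite /future_weight; congr (_ * _); rewrite !big1_seq// => x /andP[/andP[rx _] xz].
have : x.1 \in c by rewrite -(mem_sort leq) -zc; apply/mapP; exists x.
by move=> /(allP cr); rewrite ltnNge rx.
Qed.

(** Comparing [phi] with the constant 1, for which the expectation is the
    probability of the past event, eliminates the remaining series. *)
Lemma expectation_past_future r0 (phi : nat -> R) (Q : seq (nat * bool) -> bool) :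
  (r0 <= (size S).+1)%N -> (forall i, 0 <= phi i) ->
  (\int[P]_w (future_weight r0 phi Q (trials N U B S w))%:E =
   (expR (- \sum_(r0 <= i < (size S).+1)
      (1 - phi i)%R * (hazard theta q (bd i) - hazard theta q (bd i.+1))))%:E *
   P [set w | Q (past_trials r0 (trials N U B S w))])%E.
Proof.
move=> rS phi0; rewrite expectation_future//.
have -> : (P [set w | Q (past_trials r0 (trials N U B S w))] =
    \int[P]_w (future_weight r0 (fun=> 1%R) Q (trials N U B S w))%:E)%E.
  set A := [set w | _].
  have mA : measurable A by exact: (measurable_trials N U B S (fun z => Q (past_trials r0 z))).
  transitivity (\int[P]_w (\1_A w)%:E)%E; first by rewrite integral_indic// setIT.
  apply: eq_integral => w _; rewrite /future_weight big1// mulr1 indicE.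
  congr ((nat_of_bool _)%:R)%:E.
  by apply/idP/idP; [move/set_mem|move=> ?; apply/mem_set].
rewrite expectation_future// [RHS]muleA -EFinM -expRD; congr ((expR _)%:E * _)%E.
rewrite -sumrN -big_split /=; apply: eq_bigr => i _; ring.
Qed.
End Master.

(** * The rate function *)
Section Rate.
Variables (R : realType) (theta q : R).
Hypothesis theta_gt0 : 0 < theta.
Hypothesis q01 : 0 < q < 1.
Local Notation mu := (@lebesgue_measure R).

Definition rate (t : R) : R := theta / (t + q^-1 - 1).

Lemma rate_denom_gt0 t : 0 <= t -> 0 < t + q^-1 - 1.
Proof.
move=> t0; have /andP[q0 q1] := q01.
by rewrite -addrA ltr_wpDl// subr_gt0 invf_gt1.
Qed.

Lemma rate_ge0 t : 0 <= t -> 0 <= rate t.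
Proof. by move=> t0; rewrite divr_ge0 ?ltW// rate_denom_gt0. Qed.

Lemma rate_continuous t : 0 <= t -> {for t, continuous rate}.
Proof.
move=> t0; apply: cvgM; first exact: cvg_cst.
apply: cvgV; first by rewrite gt_eqF// rate_denom_gt0.
by apply: cvgB; [apply: cvgD; [exact: cvg_id|exact: cvg_cst]|exact: cvg_cst].
Qed.

Lemma rate_continuous_within a b : 0 <= a -> {within `[a, b], continuous rate}.
Proof.
move=> a0; apply: continuous_in_subspaceT => t.
by rewrite inE /= in_itv /= => /andP[at0 _]; apply: rate_continuous; exact: le_trans at0.
Qed.

Let primitive (t : R) : R := theta * ln (t + q^-1 - 1).

Let is_derive_primitive (t : R) : 0 <= t -> is_derive t (1 : R) primitive (rate t).
Proof.
move=> t0; rewrite /rate.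
have d1 : is_derive t (1 : R) (fun y : R => y + q^-1 - 1) 1.
  rewrite [X in is_derive _ _ _ X](_ : _ = 1 + 0 - 0); last by rewrite addr0 subr0.
  by apply: is_deriveB; apply: is_deriveD.
have d2 := @is_derive1_comp R (@ln R) (fun y => y + q^-1 - 1) t _ _
    (is_derive1_ln (rate_denom_gt0 t0)) d1.
rewrite mulr1 in d2.
exact: (is_deriveZ theta d2).
Qed.

Lemma integral_rate_cc (c : R) : 0 <= c < 1 ->
  (\int[mu]_(t in `[c, 1%R]) (rate t)%:E = (hazard theta q c)%:E)%E.
Proof.
move=> /andP[c0 c1]; have /andP[q0 q1] := q01.
have cp t : 0 <= t -> {for t, continuous primitive}.
  move=> t0; apply: differentiable_continuous; apply/derivable1_diffP.
  by have [] := is_derive_primitive t0.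
rewrite (@continuous_FTC2 _ _ primitive)//.
- rewrite -EFinB /primitive -mulrBr /hazard mulNr -mulrN; congr (_ * _)%:E.
  rewrite clip_id ?c0 ?ltW//.
  rewrite (_ : 1 - q * (1 - c) = q * (c + q^-1 - 1)); last by field; rewrite gt_eqF.
  rewrite lnM ?posrE ?rate_denom_gt0// opprD addrAC subrr add0r lnV ?posrE//.
- exact: rate_continuous_within.
- split.
  + move=> t; rewrite in_itv /= => /andP[ct _].
    by have [] := is_derive_primitive (le_trans c0 (ltW ct)).
  + by apply: cvg_at_right_filter; exact: cp.
  + by apply: cvg_at_left_filter; exact: cp.
- move=> t; rewrite in_itv /= => /andP[ct _]; rewrite derive1E.
  by have [_ ->] := is_derive_primitive (le_trans c0 (ltW ct)).
Qed.

Lemma measurable_rate (A : set R) : A `<=` `[0, 1] -> measurable_fun A rate.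
Proof.
move=> A01; apply: (measurable_funS _ A01) => //.
by apply: subspace_continuous_measurable_fun => //; exact: rate_continuous_within.
Qed.

Lemma integral_rate_gt (x : R) :
  (\int[mu]_(t in `[0%R, 1%R] `&` `]x, +oo[) (rate t)%:E = (hazard theta q x)%:E)%E.
Proof.
have [x0|x0] := ltP x 0.
  rewrite (_ : _ `&` _ = `[0, 1]%classic); last first.
    apply/seteqP; split => y /=; rewrite !in_itv /= ?andbT; first by case.
    by move=> /andP[y0 y1]; split; rewrite ?y0//; exact: lt_le_trans y0.
  by rewrite integral_rate_cc ?lexx ?ltr01// /hazard !clip_lt0// ltW.
have [x1|x1] := leP 1 x.
  rewrite (_ : _ `&` _ = set0); last first.
    apply/seteqP; split => y //=; rewrite !in_itv /= ?andbT => -[/andP[_ y1] xy].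
    by move: (le_lt_trans x1 xy); rewrite ltNge y1.
  by rewrite integral_set0 /hazard clip_gt1// subrr mulr0 subr0 ln1 mulr0.
rewrite (_ : _ `&` _ = `]x, 1]%classic); last first.
  apply/seteqP; split => y /=; rewrite !in_itv /= ?andbT.
    by move=> [/andP[_ ->] ->].
  move=> /andP[xy ->]; rewrite xy andbT; split => //.
  by apply: le_trans x0 (ltW xy).
rewrite integral_itv_obnd_cbnd ?integral_rate_cc ?x0//.
apply/measurable_EFinP; apply: measurable_rate => y /=; rewrite !in_itv /=.
by move=> /andP[xy ->]; rewrite andbT; exact: le_trans x0 (ltW xy).
Qed.

Lemma integrable_rate (A : set R) : measurable A -> A `<=` `[0, 1] ->
  mu.-integrable A (EFin \o rate).
Proof.
move=> mA A01; suff i01 : mu.-integrable `[0, 1] (EFin \o rate).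
  by exact: (@integrableS _ _ _ mu _ _ (EFin \o rate) _ mA A01 i01).
apply: continuous_compact_integrable; first exact: segment_compact.
exact: rate_continuous_within.
Qed.

(** The hazard increments in [expectation_past_future] are integrals of the rate
    over the cells. *)
Lemma integral_rate_cell (S : seq R) i : sorted <=%O S -> (i <= size S)%N ->
  (\int[mu]_(t in `[0%R, 1%R] `&` [set t | cell S t = i]) (rate t)%:E =
   (hazard theta q (bd S i) - hazard theta q (bd S i.+1))%:E)%E.
Proof.
move=> sS iS; pose A j := `[0, 1] `&` [set t : R | (j <= cell S t)%N].
have mge j : measurable [set x | (j <= cell S x)%N].
  have -> : [set x | (j <= cell S x)%N] =
      \bigcup_(k in [set k | (j <= k)%N]) [set x | cell S x = k].
    apply/seteqP; split => x /=; first by move=> jx; exists (cell S x).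
    by move=> [k /= jk ->].
  by apply: bigcup_measurable => k _; exact: measurable_cell.
have mA j : measurable (A j) by apply: measurableI.
have AE j : (j <= (size S).+1)%N ->
    (\int[mu]_(t in A j) (rate t)%:E = (hazard theta q (bd S j))%:E)%E.
  rewrite leq_eqVlt => /predU1P[->|].
    have -> : A (size S).+1 = set0.
      by apply/seteqP; split => x //= -[_ /=]; rewrite ltnNge count_size.
    rewrite integral_set0 /bd /= nth_default// /hazard clip_gt1 ?ler1n//.
    by rewrite subrr mulr0 subr0 ln1 mulr0.
  case: j => [_|j jS].
    have -> : A 0%N = `[0, 1] `&` `](-1), +oo[.
      apply/seteqP; split => x /=; rewrite !in_itv/= andbT => -[x01 _]; split => //.
      by have /andP[x0 _] := x01; exact: lt_le_trans (ltrN10 R) x0.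
    by rewrite integral_rate_gt.
  rewrite -integral_rate_gt; congr (integral _ (_ `&` _) _).
  by apply/seteqP; split => x /=; rewrite in_itv /= andbT (cell_geP 2).
have h : (\int[mu]_(t in A i) (rate t)%:E =
    \int[mu]_(t in `[0%R, 1%R] `&` [set t | cell S t = i]) (rate t)%:E +
    \int[mu]_(t in A i.+1) (rate t)%:E)%E.
  rewrite -ge0_integral_setU//.
  - congr (integral _ _ _); apply/seteqP; split => x /=.
      move=> [x01 ix]; move: ix => /=; rewrite leq_eqVlt => /predU1P[e|h].
        by left; split.
      by right; split.
    by case=> -[x01 /= h]; split => //=; [rewrite h|exact: ltnW].
  - by apply: measurableI => //; exact: measurable_cell.
  - exact: mA.
  - apply/measurable_EFinP; apply: measurable_rate => x /=.
    by case=> -[].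
  - by move=> x [|] [/=]; rewrite in_itv /= => /andP[x0 _] _; rewrite lee_fin rate_ge0.
  - by apply/disj_setPS => x [[_ /= e] [_ /=]]; rewrite e ltnn.
rewrite !AE// in h; last exact: leqW.
by move/(congr1 (fun z => z - (hazard theta q (bd S i.+1))%:E)%E): h; rewrite addeK// -EFinB.
Qed.
End Rate.

(** * Iterated limits of step functions *)
Section BaireFunctions.
Variable R : realType.

(** The induction principle lets an identity pass from step functions to their
    iterated pointwise limits by dominated convergence. *)
Inductive baire01 : (R -> R) -> Prop :=
| Baire01Step (S : seq R) (phi : nat -> R) : sorted <=%O S ->
    (forall i, 0 <= phi i <= 1) -> baire01 (phi \o cell S)
| Baire01Lim (f_ : nat -> R -> R) (f : R -> R) : (forall n, baire01 (f_ n)) ->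
    (forall x, f_ ^~ x @ \oo --> f x) -> baire01 f.

Lemma cell_perm (S S' : seq R) : perm_eq S S' -> cell S = cell S'.
Proof. by move=> SS'; apply/funext => x; exact/permP. Qed.

Lemma baire01_step (S : seq R) (f : R -> R) : (forall x, 0 <= f x <= 1) ->
  (forall x y, cell S x = cell S y -> f x = f y) -> baire01 f.
Proof.
move=> f01 fS; pose S' := sort <=%O S.
have SS' : cell S' = cell S by apply: cell_perm; rewrite perm_sort.
have -> : f = (fun i => f (xget 0 [set x | cell S' x = i])) \o cell S'.
  apply/funext => x /=; apply: fS; rewrite -SS'.
  by case: xgetP => [y h /= e|/(_ x)/=] //; rewrite e.
by apply: (@Baire01Step S' (fun i => f _)) => //; exact: sort_le_sorted.
Qed.

Lemma baire01_cst c : 0 <= c <= 1 -> baire01 (fun=> c).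
Proof. by move=> c01; exact: (@baire01_step [::]). Qed.

Definition mix (A : set R) (f g : R -> R) (x : R) := if x \in A then f x else g x.

Let mixing A := forall f g, baire01 f -> baire01 g -> baire01 (mix A f g).

Lemma cell_cat (S S' : seq R) x : cell (S ++ S') x = (cell S x + cell S' x)%N.
Proof. exact: count_cat. Qed.

Lemma cell_cat_inj (S S' : seq R) x y : cell (S ++ S') x = cell (S ++ S') y ->
  cell S x = cell S y /\ cell S' x = cell S' y.
Proof.
have h S0 : {in S0, forall s, (x <= s) = (y <= s)} -> cell S0 x = cell S0 y.
  by move=> e; apply: eq_in_count => s sS; rewrite !ltNge e.
by move=> /cell_eq e; split; apply: h => s sS; apply: e; rewrite mem_cat sS ?orbT.
Qed.

Lemma baire01_range f : baire01 f -> forall x, 0 <= f x <= 1.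
Proof.
elim=> [S phi _ phi01 x|f_ {}f _ f01 ff x]; first exact: phi01.
have cf : cvgn (f_ ^~ x) by apply/cvg_ex; exists (f x); exact: ff.
rewrite -(cvg_lim (@Rhausdorff R) (ff x)); apply/andP; split.
  by apply: limr_ge => //; apply: nearW => n; have /andP[] := f01 n x.
by apply: limr_le => //; apply: nearW => n; have /andP[] := f01 n x.
Qed.

Lemma baire01_measurable f : baire01 f -> measurable_fun setT f.
Proof.
elim=> [S phi _ _|f_ {}f _ mf ff].
  move=> _ Y mY; rewrite setTI.
  have -> : (phi \o cell S) @^-1` Y =
      \bigcup_(i in [set i | Y (phi i)]) [set x | cell S x = i].
    apply/seteqP; split => x /=; first by move=> Yx; exists (cell S x).
    by move=> [i /= Yi ->].
  by apply: bigcup_measurable => i _; exact: measurable_cell.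
by apply: (measurable_fun_cvg mf) => x _; exact: ff.
Qed.

Let mixing_ray t : mixing `]t, +oo[.
Proof.
have base S phi S' psi : (forall i, 0 <= phi i <= 1) -> (forall i, 0 <= psi i <= 1) ->
    baire01 (mix `]t, +oo[ (phi \o cell S) (psi \o cell S')).
  move=> phi01 psi01; apply: (@baire01_step ([:: t] ++ (S ++ S'))) => [x|x y].
    by rewrite /mix; case: ifP => _; [exact: phi01|exact: psi01].
  move=> /cell_cat_inj[/cell_eq e /cell_cat_inj[e1 e2]].
  rewrite /mix /= e1 e2 (_ : (x \in `]t, +oo[%classic) = (y \in `]t, +oo[%classic))//.
  apply/idP/idP; rewrite !inE /= !in_itv /= !andbT !ltNge e ?inE//.
move=> f g bf; elim: bf g => [S phi _ phi01|f_ {}f _ IH ff] g bg.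
  elim: bg => [S' psi _ psi01|g_ {}g _ IH gg]; first exact: base.
  apply: (Baire01Lim IH) => x; rewrite /mix; case: ifP => _ //; exact: cvg_cst.
apply: (@Baire01Lim (fun n => mix `]t, +oo[ (f_ n) g)); first by move=> n; exact: IH.
by move=> x; rewrite /mix; case: ifP => _ //; exact: cvg_cst.
Qed.

(** Every Borel set may be used to glue two functions: the sets with this property
    include the rays and form a sigma-algebra. *)
Lemma baire01_mix A f g : measurable A -> baire01 f -> baire01 g ->
  baire01 (mix A f g).
Proof.
move=> mA; suff : mixing A by apply.
have : (@RGenOInfty.G R).-sigma.-measurable A by rewrite -RGenOInfty.measurableE.
apply: smallest_sub => {mA A f g}; last first.
  by move=> _ [t ->]; exact: mixing_ray.
have mixU A A' : mixing A -> mixing A' -> mixing (A `|` A').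
  move=> mA mA' f g bf bg; rewrite (_ : mix _ _ _ = mix A f (mix A' f g)).
    exact: mA (mA' _ _ _ _).
  by apply/funext => x; rewrite /mix in_setU; case: (x \in A).
have mix0 : mixing set0.
  move=> f g bf bg; rewrite (_ : mix _ _ _ = g)//.
  by apply/funext => x; rewrite /mix in_set0.
split => //.
- move=> A mA f g bf bg; rewrite (_ : mix _ _ _ = mix A g f); first exact: mA.
  by apply/funext => x; rewrite /mix setTD in_setC; case: (x \in A).
- move=> A mA f g bf bg.
  apply: (@Baire01Lim (fun n => mix (\big[setU/set0]_(i < n) A i) f g)).
    move=> n; suff : mixing (\big[setU/set0]_(i < n) A i) by apply.
    by elim/big_ind: _ => // i _; exact: mA.
  move=> x; have [[n _ Anx]|nAx] := pselect ((\bigcup_k A k) x).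
    apply: cvg_near_cst; exists n.+1 => // m /= nm.
    rewrite /mix mem_set ?mem_set//; first by exists n.
    by rewrite -bigcup_mkord; exists n.
  apply: cvg_near_cst; apply: nearW => m.
  rewrite /mix !memNset// -bigcup_mkord => -[k _ Akx]; apply: nAx; by exists k.
Qed.
End BaireFunctions.

(** * The generating functional of the success epochs *)
Section SuccessFunctional.
Context d (T : measurableType d) (R : realType) (P : probability T R).
Variables (theta q : R).
Variables (N : {RV P >-> nat}) (U : nat -> {RV P >-> R}) (B : nat -> {RV P >-> bool}).
Hypothesis theta_gt0 : 0 < theta.
Hypothesis q01 : 0 < q < 1.
Hypothesis model : trials_model (negative_binomial_pmf theta q)
               (fun k => theta / (theta + k%:R - 1)) N U B.
Local Notation mu := (@lebesgue_measure R).

Definition lost_rate (f : R -> R) : \bar R :=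
  (\int[mu]_(t in `[0%R, 1%R]) ((1 - f t) * rate theta q t)%:E)%E.

Lemma measurable_lost_rate (f : R -> R) (A : set R) : A `<=` `[0, 1] ->
  measurable_fun setT f ->
  measurable_fun A (EFin \o (fun t => (1 - f t) * rate theta q t)).
Proof.
move=> A01 mf; apply/measurable_EFinP; apply: measurable_funM.
  by apply: measurable_funB; [exact: measurable_cst|exact: measurable_funTS].
exact: measurable_rate.
Qed.

Lemma lost_rate_step S (phi : nat -> R) : sorted <=%O S ->
  (forall i, 0 <= phi i <= 1) ->
  lost_rate (phi \o cell S) = (\sum_(0 <= i < (size S).+1)
     (1 - phi i) * (hazard theta q (bd S i) - hazard theta q (bd S i.+1)))%:E.
Proof.
move=> sS phi01; rewrite /lost_rate.
pose A i := `[0, 1] `&` [set t : R | cell S t = i].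
have mA i : measurable (A i) by apply: measurableI => //; exact: measurable_cell.
have -> : `[0%R, 1%R]%classic = \big[setU/set0]_(i <- index_iota 0 (size S).+1) A i.
  rewrite -bigcup_seq; apply/seteqP; split => x /=.
    by move=> x01; exists (cell S x) => //=; rewrite mem_index_iota /= cell_lt.
  by move=> [i _ []].
rewrite ge0_integral_bigsetU//=.
- rewrite -sumEFin big_seq [RHS]big_seq; apply: eq_bigr => i.
  rewrite mem_index_iota => /andP[_ iS].
  rewrite EFinM -integral_rate_cell// -ge0_integralZl_EFin//.
  + by apply: eq_integral => t; rewrite inE => -[_ /= ->].
  + exact: (mA i).
  + by move=> t [+ _]; rewrite /= in_itv /= => /andP[t0 _]; rewrite lee_fin rate_ge0.
  + by apply/measurable_EFinP; apply: (measurable_rate theta q01) => t [].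
  + by rewrite subr_ge0; have /andP[] := phi01 i.
- exact: (iota_uniq 0 (size S).+1).
- by move=> i j _ _ [t [[_ /= <-] [_ /= <-]]].
- apply: measurable_lost_rate; first by move=> t; rewrite -bigcup_seq => -[i _ []].
  by apply: baire01_measurable; exact: Baire01Step.
- move=> t; rewrite -bigcup_seq => -[i _ [+ _]]; rewrite /= in_itv /= => /andP[t0 _].
  by rewrite lee_fin mulr_ge0 ?rate_ge0// subr_ge0; have /andP[] := phi01 (cell S t).
Qed.

Lemma success_prod_step S (phi : nat -> R) w :
  future_weight 0 phi xpredT (trials N U B S w) = success_prod N U B (phi \o cell S) w.
Proof.
rewrite /future_weight /= mul1r /success_prod /success_epochs /trials.
by rewrite !big_map big_filter; apply: eq_bigl.
Qed.

Lemma success_prod_ge0le1 (f : R -> R) w : (forall x, 0 <= f x <= 1) ->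
  0 <= success_prod N U B f w <= 1.
Proof.
move=> f01; rewrite /success_prod; elim: (success_epochs _ _ _ _) => [|x s IHs].
  by rewrite big_nil ler01 lexx.
rewrite big_cons; have /andP[f0 f1] := f01 x; have /andP[s0 s1] := IHs.
by rewrite mulr_ge0//= mulr_ile1.
Qed.

Lemma lost_rate_fin f : baire01 f -> lost_rate f \is a fin_num.
Proof.
move=> bf; have f01 := baire01_range bf.
have i01 : mu.-integrable `[0, 1] (EFin \o (fun t => (1 - f t) * rate theta q t)).
  have ir : mu.-integrable `[0, 1] (EFin \o rate theta q) by exact: integrable_rate.
  apply: (le_integrable _ _ _ ir) => //.
    by apply: measurable_lost_rate => //; exact: baire01_measurable.
  move=> t /=; rewrite in_itv /= => /andP[t0 _]; rewrite lee_fin.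
  have /andP[ft0 ft1] := f01 t.
  have r0 : 0 <= rate theta q t by exact: rate_ge0.
  by rewrite !ger0_norm// ?ler_piMl ?lerBlDr ?lerDl// mulr_ge0// subr_ge0.
exact: integrable_fin_num i01.
Qed.

(** Step functions are the case of [expectation_past_future] without past; both
    sides are continuous for bounded pointwise convergence. *)
Theorem expectation_success_prod f : baire01 f ->
  (\int[P]_w (success_prod N U B f w)%:E = (expR (- fine (lost_rate f)))%:E)%E.
Proof.
elim=> [S phi sS phi01|f_ {}f bf_ IH ff].
  under eq_integral do rewrite -success_prod_step.
  rewrite (expectation_past_future theta_gt0 q01 model sS)//; last first.
    by move=> i; have /andP[] := phi01 i.
  rewrite lost_rate_step//= (_ : [set w | _] = setT); last by apply/seteqP; split.
  by rewrite probability_setT mule1.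
have bf : baire01 f by exact: Baire01Lim ff.
have mG g : baire01 g -> measurable_fun setT (fun w => (success_prod N U B g w)%:E).
  by move=> bg; apply/measurable_EFinP; apply: measurable_success_prod; exact: baire01_measurable.
have G01 g w : baire01 g -> 0 <= success_prod N U B g w <= 1.
  by move=> bg; apply: success_prod_ge0le1; exact: baire01_range.
(* The products over the success epochs are bounded by 1 and converge. *)
have [||_ _ cG] := @dominated_convergence _ _ _ P _ measurableT
  (fun n w => (success_prod N U B (f_ n) w)%:E) (fun w => (success_prod N U B f w)%:E)
  (EFin \o cst 1) (fun n => mG _ (bf_ n)) (mG _ bf) _
  (finite_measure_integrable_cst P 1 measurableT).
- apply: aeW => w _ /=; apply: cvg_EFin; first exact: nearW.
  rewrite /comp /= /success_prod; elim: (success_epochs _ _ _ _) => [|t s IHs].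
    by under eq_fun do rewrite big_nil; rewrite big_nil; exact: cvg_cst.
  under eq_fun do rewrite big_cons; rewrite big_cons; apply: cvgM => //; exact: ff.
- apply: aeW => w n _ /=; rewrite lee_fin ger0_norm//;
  by have /andP[] := G01 _ w (bf_ n).
have m01 (g : R -> R) : baire01 g ->
    measurable_fun (`[0, 1]%classic : set R) (EFin \o (fun t => (1 - g t) * rate theta q t)).
  by move=> bg; apply: measurable_lost_rate => //; exact: baire01_measurable.
(* The exponents converge too, dominated by the rate itself. *)
have [||_ _ cL] := @dominated_convergence _ _ _ mu (`[0, 1]%classic : set R) (measurable_itv _)
  (fun n t => ((1 - f_ n t) * rate theta q t)%:E) (fun t => ((1 - f t) * rate theta q t)%:E)
  (EFin \o rate theta q) (fun n => m01 _ (bf_ n)) (m01 _ bf) _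
  (integrable_rate theta q01 (measurable_itv _) (fun _ => id)).
- apply: aeW => t _ /=; apply: cvg_EFin; first exact: nearW.
  apply: cvgM; last exact: cvg_cst.
  by apply: cvgB; [exact: cvg_cst|exact: ff].
- apply: aeW => t n /=; rewrite in_itv /= => /andP[t0 _]; rewrite lee_fin.
  have /andP[ft0 ft1] := baire01_range (bf_ n) t.
  have r0 : 0 <= rate theta q t by exact: rate_ge0.
  by rewrite ger0_norm ?ler_piMl ?lerBlDr ?lerDl// mulr_ge0// subr_ge0.
have cE : (expR (- fine (lost_rate (f_ n))))%:E @[n --> \oo] -->
    (expR (- fine (lost_rate f)))%:E.
  apply: cvg_EFin; first exact: nearW.
  apply: (@continuous_cvg _ _ _ _ _ (fun n => - fine (lost_rate (f_ n))) expR).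
    exact: continuous_expR.
  apply: cvgN; apply: fine_cvg; rewrite fineK ?lost_rate_fin//; exact: cL.
apply: (@cvg_unique _ (@ereal_hausdorff R)) cG _.
by apply: cvg_trans cE; apply: near_eq_cvg; apply: nearW => n; rewrite /= IH.
Qed.
End SuccessFunctional.

(** * From generating functions to laws *)

(** If all coefficients before [c n] vanish, the tail of the series is at most
    [2 * K * z] times [z ^ n], so [c n] is bounded by [2 * K * z] for every small
    [z]. *)
Lemma power_series_eq0 (R : realType) (c : nat -> R) (K : R) :
  (forall n, `|c n| <= K) ->
  (forall z : R, 0 < z <= 2^-1 -> series (fun n => c n * z ^+ n) @ \oo --> 0) ->
  forall n, c n = 0.
Proof.
move=> cK c0; have K0 : 0 <= K by exact: le_trans (cK 0%N).
have geo (z : R) n m : 0 < z <= 2^-1 -> (n <= m)%N ->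
    \sum_(n <= k < m) z ^+ k <= 2 * z ^+ n.
  move=> /andP[z0 z2] nm.
  have tele : (1 - z) * \sum_(n <= k < m) z ^+ k = z ^+ n - z ^+ m.
    have := telescope_sumr (fun k => - z ^+ k) nm.
    rewrite /= opprK addrC mulr_sumr => <-.
    by apply: eq_bigr => k _; rewrite exprS; ring.
  have zn0 k : 0 <= z ^+ k by rewrite exprn_ge0// ltW.
  have s0 : 0 <= \sum_(n <= k < m) z ^+ k by apply: sumr_ge0 => k _.
  by have := zn0 n; have := zn0 m; nra.
move=> n; have [k] := ubnP n; elim: k n => // k IHk n /ltnSE nk.
have {}IHk j : (j < n)%N -> c j = 0.
  by move=> jn; apply: IHk; exact: leq_trans nk.
have bound (z : R) : 0 < z <= 2^-1 -> `|c n| <= 2 * K * z.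
  move=> z01; have /andP[z0 _] := z01; have zn0 : 0 < z ^+ n by rewrite exprn_gt0.
  have cv : (fun N => `|series (fun n => c n * z ^+ n) N|) @ \oo --> (0 : R).
    by rewrite -[X in _ --> X](normr0 R); apply: cvg_norm; exact: c0.
  suff : `|c n| * z ^+ n - 2 * K * z * z ^+ n <=
      limn (fun N => `|series (fun n => c n * z ^+ n) N|).
    by rewrite (cvg_lim (@Rhausdorff R) cv) subr_le0 ler_pM2r.
  apply: limr_ge; first by apply/cvg_ex; exists 0.
  near=> N.
  have nN : (n < N)%N by near: N; exists n.+1.
  rewrite /series /= (big_cat_nat (n := n))//=; last exact: ltnW.
  rewrite big1_seq ?add0r; last first.
    by move=> j; rewrite mem_index_iota /= => jn; rewrite IHk ?mul0r.
  rewrite big_ltn//.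
  have tail : `|\sum_(n.+1 <= j < N) c j * z ^+ j| <= 2 * K * z * z ^+ n.
    apply: (le_trans (ler_norm_sum _ _ _)).
    apply: (@le_trans _ _ (\sum_(n.+1 <= j < N) K * z ^+ j)).
      apply: ler_sum => j _; rewrite normrM ler_pM// normrX gtr0_norm//.
    by rewrite -mulr_sumr -!mulrA -exprS mulrCA ler_wpM2l// geo.
  have : `|c n * z ^+ n| = `|c n| * z ^+ n by rewrite normrM (gtr0_norm zn0).
  move: (c n * z ^+ n) (\sum_(_ <= _ < _) _) tail => u v tail <-.
  by have := ler_normB (u + v) v; rewrite addrK => h; lra.
have [//|cn0] := eqVneq (c n) 0.
have cn : 0 < `|c n| by rewrite normr_gt0.
have K1 : 0 < 4 * K + 1 by lra.
(* Small enough for the bound [2 * K * z] to fall below [`|c n|]. *)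
pose z : R := Num.min 2^-1 (`|c n| / (4 * K + 1)).
have z0 : 0 < z by rewrite /z lt_min invr_gt0 ltr0n divr_gt0.
have := bound z; rewrite z0 /z ge_min lexx -/z => /(_ isT) h.
have : z * (4 * K + 1) <= `|c n|.
  by rewrite -ler_pdivlMr// /z ge_min lexx orbT.
by move: h z0 K0 cn; clear; nra.
Unshelve. all: by end_near.
Qed.

(** The weight [W] carries the factors belonging to other counts, so that
    independence can be obtained one count at a time. *)
Lemma poisson_pgf_unique d (T : measurableType d) (R : realType) (P : probability T R)
    (X : T -> nat) (W : T -> R) (m w0 : R) :
  measurable_fun setT X -> measurable_fun setT W -> (forall w, 0 <= W w <= 1) ->
  0 <= m ->
  (forall z : R, 0 <= z <= 1 ->
    (\int[P]_w (z ^+ X w * W w)%:E = (expR (- ((1 - z) * m)) * w0)%:E)%E) ->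
  forall n, (\int[P]_(w in [set w | X w = n]) (W w)%:E =
    (m ^+ n / n`!%:R * expR (- m) * w0)%:E)%E.
Proof.
move=> mX mW W01 m0 pgf.
have mXn n : measurable [set w | X w = n].
  by have := mX measurableT [set n]; rewrite setTI; apply.
have mWD D : measurable D -> measurable_fun D (EFin \o W).
  by move=> mD; apply/measurable_EFinP; exact: measurable_funTS.
have W0 w : 0 <= W w by have /andP[] := W01 w.
have W1 w : W w <= 1 by have /andP[] := W01 w.
pose I n := (\int[P]_(w in [set w | X w = n]) (W w)%:E)%E.
have I0 n : (0 <= I n)%E by apply: integral_ge0 => w _; rewrite lee_fin.
have I1 n : (I n <= 1)%E.
  apply: (@le_trans _ _ (\int[P]_(w in [set w | X w = n]) cst 1%E w)%E).
    by apply: ge0_le_integral => //= [w _||w _]; rewrite ?lee_fin//; exact: mWD.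
  by rewrite integral_cst// mul1e probability_le1.
have If n : I n \is a fin_num.
  by rewrite ge0_fin_numE// (le_lt_trans (I1 n))// ltry.
pose a n := fine (I n); pose b n := m ^+ n / n`!%:R * expR (- m) * w0.
have aE n : I n = (a n)%:E by rewrite /a fineK.
have a01 n : 0 <= a n <= 1 by rewrite -!lee_fin -aE I0 I1.
have bK n : `|b n| <= `|w0|.
  rewrite /b normrM ler_piMl// ger0_norm; last first.
    by rewrite mulr_ge0 ?expR_ge0// divr_ge0// exprn_ge0.
  rewrite expRN ler_pdivrMr ?expR_gt0// mul1r.
  case: n => [|n]; first by rewrite expr0 fact0 divr1 -expR0 ler_expR.
  by have := expR_ge1Dxn n m0; lra.
suff ab n : a n - b n = 0.
  by move=> n; rewrite -/(I n) aE; congr EFin; apply/eqP; rewrite -subr_eq0 ab.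
apply: (@power_series_eq0 R (fun n => a n - b n) (1 + `|w0|)) => {n} [n|z].
  apply: le_trans (ler_normB _ _) _; apply: lerD => //.
  by have /andP[a0 a1] := a01 n; rewrite ger0_norm.
move=> /andP[z0 z2]; have z1 : z <= 1 by lra.
have za : series (fun n => a n * z ^+ n) @ \oo --> expR (- ((1 - z) * m)) * w0.
  have e : (\sum_(n <oo) (a n * z ^+ n)%:E = (expR (- ((1 - z) * m)) * w0)%:E)%E.
    rewrite -pgf ?(ltW z0)//.
    have -> : [set: T] = \bigcup_n [set w | X w = n].
      by apply/seteqP; split => // w _; exists (X w).
    rewrite ge0_integral_bigcup//.
    - apply: eq_eseriesr => n _; rewrite EFinM -aE muleC /I.
      rewrite -ge0_integralZl_EFin ?exprn_ge0 ?(ltW z0)//; last 2 first.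
      + by move=> w _; rewrite lee_fin.
      + exact: mWD.
      by apply: eq_integral => w; rewrite inE /= => ->.
    - apply/measurable_EFinP; apply: measurable_funTS; apply: measurable_funM => //.
      exact: (measurableT_comp (f := fun k => z ^+ k)).
    - by move=> w _; rewrite lee_fin mulr_ge0 ?exprn_ge0 ?(ltW z0).
    - by move=> i j _ _ [w [/= <- <-]].
  have cv : (fun n => \sum_(0 <= k < n) (a k * z ^+ k)%:E)%E @ \oo -->
      (expR (- ((1 - z) * m)) * w0)%:E.
    rewrite -e; apply: is_cvg_nneseries => k _ _.
    by rewrite lee_fin mulr_ge0 ?exprn_ge0 ?(ltW z0)//; have /andP[] := a01 k.
  move/fine_cvg: cv; apply: cvg_trans; apply: near_eq_cvg; apply: nearW => n.
  by rewrite /= sumEFin.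
have zb : series (fun n => b n * z ^+ n) @ \oo --> expR (- ((1 - z) * m)) * w0.
  have h := is_cvg_series_exp_coeff (m * z).
  have cv : series (exp_coeff (m * z)) @ \oo --> expR (m * z) by exact: h.
  have -> : - ((1 - z) * m) = m * z + - m by ring.
  rewrite expRD -mulrA.
  rewrite (_ : series _ = (fun n => series (exp_coeff (m * z)) n * (expR (- m) * w0))).
    by apply: cvgM => //; exact: cvg_cst.
  apply/funext => n; rewrite /series /= mulr_suml; apply: eq_bigr => k _.
  by rewrite /b /exp_coeff /= exprMn; ring.
rewrite (_ : series _ = (fun n => series (fun n => a n * z ^+ n) n -
                                 series (fun n => b n * z ^+ n) n)).
  by rewrite -(subrr (expR (- ((1 - z) * m)) * w0)); exact: cvgB.
apply/funext => n; rewrite /series /= -sumrB.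
by apply: eq_bigr => k _; rewrite mulrBl.
Qed.

(** * The Poisson process of success epochs *)
Section PoissonLaw.
Context d (T : measurableType d) (R : realType) (P : probability T R).
Variables (theta q : R).
Variables (N : {RV P >-> nat}) (U : nat -> {RV P >-> R}) (B : nat -> {RV P >-> bool}).
Hypothesis theta_gt0 : 0 < theta.
Hypothesis q01 : 0 < q < 1.
Hypothesis model : trials_model (negative_binomial_pmf theta q)
               (fun k => theta / (theta + k%:R - 1)) N U B.
Local Notation mu := (@lebesgue_measure R).
Local Notation C := (success_count N U B).

Definition mean_count (A : set R) : R := \int[mu]_(t in A) rate theta q t.

Lemma mean_countE (A : set R) : measurable A -> A `<=` `[0, 1] ->
  (\int[mu]_(t in A) (rate theta q t)%:E = (mean_count A)%:E)%E.
Proof.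
move=> mA A01; rewrite /mean_count /Rintegral fineK//.
have i := integrable_rate theta q01 mA A01.
exact: (@integrable_fin_num _ _ _ mu A mA _ i).
Qed.

Lemma mean_count_ge0 (A : set R) : A `<=` `[0, 1] -> 0 <= mean_count A.
Proof.
move=> A01; apply: fine_ge0; apply: integral_ge0 => t /A01 /=.
by rewrite in_itv /= => /andP[t0 _]; rewrite lee_fin rate_ge0.
Qed.

(** With [success_prod_mix]: giving the value [z] to a new set on which the
    function was 1 inserts one more variable into the generating function. *)
Lemma lost_rate_mix (A : set R) z h : measurable A -> A `<=` `[0, 1] ->
  0 <= z <= 1 -> baire01 h -> (forall t, A t -> h t = 1) ->
  lost_rate theta q (mix A (fun=> z) h) =
  (((1 - z) * mean_count A)%:E + lost_rate theta q h)%E.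
Proof.
move=> mA A01 z01 bh h1; rewrite /lost_rate EFinM -mean_countE//.
have z1 : 0 <= 1 - z by rewrite subr_ge0; case/andP: z01.
have r0 (t : R) : `[0, 1]%classic t -> 0 <= rate theta q t.
  by rewrite /= in_itv /= => /andP[t0 _]; exact: rate_ge0.
rewrite -ge0_integralZl_EFin//; last 2 first.
- by move=> t /A01 t01; rewrite lee_fin r0.
- by apply/measurable_EFinP; exact: measurable_rate.
rewrite -[in X in (_ = X + _)%E](setIidr A01) [X in (_ = X + _)%E]integral_mkcondr.
rewrite -ge0_integralD//.
- apply: eq_integral => t _; rewrite patchE /mix; case: ifPn => tA.
    by rewrite h1; [rewrite -EFinM -EFinD; congr EFin; ring|exact: set_mem].
  by rewrite add0e.
- move=> t t01; rewrite patchE; case: ifP => // _.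
  by rewrite -EFinM lee_fin mulr_ge0// r0.
- apply/measurable_restrict => //; rewrite setIidr//.
  apply/measurable_EFinP; apply: measurable_funM; first exact: measurable_cst.
  exact: measurable_rate.
- move=> t t01; rewrite lee_fin mulr_ge0 ?r0// subr_ge0.
  by have /andP[] := baire01_range bh t.
- by apply: measurable_lost_rate => //; exact: baire01_measurable.
Qed.

Lemma success_prod_mix (A : set R) z h w : (forall t, A t -> h t = 1) ->
  success_prod N U B (mix A (fun=> z) h) w = z ^+ C A w * success_prod N U B h w.
Proof.
move=> h1; rewrite /success_prod /success_count.
elim: (success_epochs _ _ _ _) => [|t s IHs]; first by rewrite !big_nil mulr1.
rewrite !big_cons IHs /= /mix; case: ifPn => tA; last by rewrite add0n mulrCA.
by rewrite h1 ?mul1r ?add1n ?exprS ?mulrA//; exact: set_mem.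
Qed.

(** The functional is evaluated at the function equal to [z i] on [A i] for [i]
    in [s] and to 1 elsewhere. *)
Lemma count_pgf (A : nat -> set R) (z : nat -> R) (s : seq nat) :
  (forall i, measurable (A i)) -> (forall i, A i `<=` `[0, 1]) ->
  trivIset setT A -> uniq s -> (forall i, 0 <= z i <= 1) ->
  (\int[P]_w (\prod_(i <- s) z i ^+ C (A i) w)%:E =
   (\prod_(i <- s) expR (- ((1 - z i) * mean_count (A i))))%:E)%E.
Proof.
move=> mA A01 tA us z01.
have [f [bf f1 fw fl]] : exists f, [/\ baire01 f,
    (forall i, i \notin s -> forall t, A i t -> f t = 1),
    (forall w, success_prod N U B f w = \prod_(i <- s) z i ^+ C (A i) w) &
    lost_rate theta q f = (\sum_(i <- s) (1 - z i) * mean_count (A i))%:E].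
  elim: s us => [_|i s IHs /= /andP[nis /IHs[f [bf f1 fw fl]]]].
    exists (fun=> 1); split => //.
    - by apply: baire01_cst; rewrite ler01 lexx.
    - by move=> w; rewrite big_nil /success_prod big1.
    - rewrite big_nil /lost_rate; under eq_integral do rewrite subrr mul0r.
      exact: integral0.
  exists (mix (A i) (fun=> z i) f); split.
  - by apply: baire01_mix => //; exact: baire01_cst.
  - move=> j; rewrite inE negb_or => /andP[ji js] t Ajt; rewrite /mix memNset ?(f1 j)//.
    move=> Ait; move/eqP: ji; apply; apply: tA => //; by exists t.
  - by move=> w; rewrite success_prod_mix ?big_cons ?fw//; exact: f1.
  - by rewrite lost_rate_mix// ?fl ?big_cons// => t; exact: f1.
under eq_integral do rewrite -fw.
rewrite (expectation_success_prod theta_gt0 q01 model bf) fl /=; congr EFin.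
by rewrite -sumrN expR_sum.
Qed.

Lemma count_law (A : set R) n : measurable A -> A `<=` `[0, 1] ->
  P [set w | C A w = n] =
  (mean_count A ^+ n / n`!%:R * expR (- mean_count A))%:E.
Proof.
move=> mA A01; have mC := measurable_success_count N U B mA.
have m0 := mean_count_ge0 A01.
have h := @poisson_pgf_unique _ _ R P (C A) (fun=> 1) (mean_count A) 1 mC
  (measurable_cst _) _ m0.
have mn : measurable [set w | C A w = n].
  by have := mC measurableT [set n]; rewrite setTI; apply.
rewrite -[LHS]mul1e -integral_cst// (h _ _ n) ?mulr1// => [w|z z01].
  by rewrite ler01 lexx.
rewrite mulr1; have := @count_pgf (fun i => if i is 0%N then A else set0)
  (fun=> z) [:: 0%N]; rewrite big_seq1 => <- //.
- by apply: eq_integral => w _; rewrite big_seq1 mulr1.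
- by case.
- by case=> [|i] t //; exact: A01.
- by move=> [|i] [|j] _ _ //= [t [//]].
Qed.

Lemma integral_indicator_value (X : T -> nat) (W : T -> R) (w0 : R) (V : set nat) :
  measurable_fun setT X -> measurable_fun setT W -> (forall w, 0 <= W w) -> 0 <= w0 ->
  (forall n, \int[P]_(w in [set w | X w = n]) (W w)%:E =
     P [set w | X w = n] * w0%:E)%E ->
  (\int[P]_w (\1_V (X w) * W w)%:E = P [set w | V (X w)] * w0%:E)%E.
Proof.
move=> mX mW W0 w00 XW.
have mXn n : measurable [set w | X w = n].
  by have := mX measurableT [set n]; rewrite setTI; apply.
have mV : measurable [set w | V (X w)].
  by have := mX measurableT V; rewrite setTI; apply.
have mVX : measurable_fun setT (fun w => \1_V (X w) : R).
  exact: (measurableT_comp (f := \1_V : nat -> R)).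
have T_X : [set: T] = \bigcup_n [set w | X w = n].
  by apply/seteqP; split => // w _; exists (X w).
have tX : trivIset setT (fun n => [set w | X w = n]).
  by move=> i j _ _ [w [/= <- <-]].
have -> : P [set w | V (X w)] = (\int[P]_w (\1_V (X w))%:E)%E.
  by have := integral_indic P measurableT mV; rewrite setIT => <-.
rewrite T_X !ge0_integral_bigcup//; last 3 first.
- by apply/measurable_EFinP; exact: measurable_funTS.
- by apply/measurable_EFinP; apply: measurable_funTS; exact: measurable_funM.
- by move=> w _; rewrite lee_fin mulr_ge0.
rewrite muleC -nneseriesZl; last by move=> n _; apply: integral_ge0 => w _; rewrite lee_fin.
apply: eq_eseriesr => n _.
transitivity (\int[P]_(w in [set w | X w = n]) ((\1_V n)%:E * (W w)%:E))%E.
  by apply: eq_integral => w; rewrite inE /= => ->; rewrite EFinM.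
rewrite ge0_integralZl_EFin//; last 2 first.
- by move=> w _; rewrite lee_fin.
- by apply/measurable_EFinP; exact: measurable_funTS.
rewrite XW muleA [RHS]muleC; congr (_ * _)%E.
rewrite -integral_cst//; apply: eq_integral => w; rewrite inE /= => ->//.
Qed.

(** One variable at a time, generating functions are replaced by indicators of
    arbitrary sets of values: the indices in [s'] have yet to be treated. *)
Lemma count_joint (A : nat -> set R) (V : nat -> set nat) (z : nat -> R) (s s' : seq nat) :
  (forall i, measurable (A i)) -> (forall i, A i `<=` `[0, 1]) ->
  trivIset setT A -> uniq (s ++ s') -> (forall i, 0 <= z i <= 1) ->
  (\int[P]_w (\prod_(i <- s) \1_(V i) (C (A i) w) * \prod_(i <- s') z i ^+ C (A i) w)%:E =
   (\prod_(i <- s) fine (P [set w | V i (C (A i) w)]) *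
    \prod_(i <- s') expR (- ((1 - z i) * mean_count (A i))))%:E)%E.
Proof.
move=> mA A01 tA.
have meange0 i : 0 <= mean_count (A i) by exact: mean_count_ge0.
have fineP i : P [set w | V i (C (A i) w)] = (fine (P [set w | V i (C (A i) w)]))%:E.
  rewrite fineK// fin_num_measure//.
  by have := measurable_success_count N U B (mA i) measurableT (Y := V i); rewrite setTI; apply.
elim: s s' z => [|i s IHs] s' z us z01.
  under eq_integral do rewrite big_nil mul1r.
  by rewrite big_nil mul1r count_pgf.
pose W w := \prod_(j <- s) \1_(V j) (C (A j) w) * \prod_(j <- s') z j ^+ C (A j) w.
pose w0 := \prod_(j <- s) fine (P [set w | V j (C (A j) w)]) *
    \prod_(j <- s') expR (- ((1 - z j) * mean_count (A j))).
have := us; rewrite /= mem_cat negb_or => /andP[/andP[nis nis'] us'].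
have mW : measurable_fun setT W.
  apply: measurable_funM.
    apply: measurable_prod => j _.
    exact: (measurableT_comp (f := \1_(V j) : nat -> R) _ (measurable_success_count N U B (mA j))).
  apply: measurable_prod => j _.
  exact: (measurableT_comp (f := fun n => z j ^+ n) _ (measurable_success_count N U B (mA j))).
have W01 w : 0 <= W w <= 1.
  rewrite /W; apply/andP; split.
    by apply: mulr_ge0; apply: prodr_ge0 => j _; rewrite ?exprn_ge0//; case/andP: (z01 j).
  apply: mulr_ile1; try by apply: prodr_ge0 => j _; rewrite ?exprn_ge0//; case/andP: (z01 j).
    by apply: prodr_ile1 => j _; rewrite indicE; case: (_ \in _); rewrite ?ler01 lexx.
  by apply: prodr_ile1 => j _; have /andP[zj0 zj1] := z01 j; rewrite exprn_ge0// exprn_ile1.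
have w00 : 0 <= w0.
  by apply: mulr_ge0; apply: prodr_ge0 => j _; rewrite ?expR_ge0// fine_ge0.
have key := @integral_indicator_value (C (A i)) W w0 (V i) (measurable_success_count N U B (mA i)) mW
  (fun w => proj1 (andP (W01 w))) w00 _.
transitivity (P [set w | V i (C (A i) w)] * w0%:E)%E; last first.
  by rewrite fineP -EFinM big_cons /w0 mulrA.
rewrite -key; last first.
  move=> n; rewrite count_law// -EFinM.
  apply: poisson_pgf_unique => // [|x x01]; first exact: measurable_success_count.
  pose z' j := if j == i then x else z j.
  have z'E : \prod_(j <- s') expR (- ((1 - z' j) * mean_count (A j))) =
      \prod_(j <- s') expR (- ((1 - z j) * mean_count (A j))).
    apply: eq_big_seq => j js'; rewrite /z' ifN//.
    by apply: contraNneq nis' => <-.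
  have := IHs (i :: s') z' ; rewrite big_cons z'E /z' eqxx => h.
  rewrite [RHS](_ : _ = (\prod_(j <- s) fine (P [set w | V j (C (A j) w)]) *
       (expR (- ((1 - x) * mean_count (A i))) *
        \prod_(j <- s') expR (- ((1 - z j) * mean_count (A j)))))%:E); last first.
    by rewrite /w0; congr EFin; ring.
  rewrite -h.
  - apply: eq_integral => w _; rewrite /W big_cons eqxx; congr EFin.
    rewrite mulrCA; congr (_ * (_ * _)); apply: eq_big_seq => j js'; rewrite ifN//.
    by apply: contraNneq nis' => <-.
  - by rewrite (perm_uniq (permEl (perm_catCA s [:: i] s'))).
  - by move=> j; case: ifP.
by apply: eq_integral => w _; rewrite big_cons /W mulrA.
Qed.

Lemma count_independent (A : nat -> set R) :
  (forall i, measurable (A i)) -> (forall i, A i `<=` `[0, 1]) ->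
  trivIset setT A ->
  mutually_independent P (fun i => generated_events (C (A i))).
Proof.
move=> mA A01 tA s E us EV.
have {}EV i : exists V : set nat, i \in s -> E i = [set w | V (C (A i) w)].
  have [/EV[V _ <-]|_] := boolP (i \in s); last by exists set0.
  by exists V => _; rewrite setTI.
have [V EVs] := choice EV.
have mV i : measurable [set w | V i (C (A i) w)].
  by have := measurable_success_count N U B (mA i) measurableT (Y := V i); rewrite setTI; apply.
have -> : \bigcap_(i in [set` s]) E i = \bigcap_(i in [set` s]) [set w | V i (C (A i) w)].
  by apply: eq_bigcapr => i /= /EVs.
have -> : (\prod_(i <- s) P (E i) = (\prod_(i <- s) fine (P [set w | V i (C (A i) w)]))%:E)%E.
  by rewrite -prodEFin; apply: eq_big_seq => i /EVs ->; rewrite fineK// fin_num_measure.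
have := count_joint V (s := s) (s' := [::]) (z := fun=> 0) mA A01 tA.
rewrite cats0 big_nil mulr1 => <- //; last by move=> _; rewrite lexx ler01.
under eq_integral do rewrite big_nil mulr1.
set D := \bigcap_(i in _) _.
have mD : measurable D by apply: fin_bigcap_measurable.
have := integral_indic P measurableT mD; rewrite setIT => <-.
apply: eq_integral => w _; congr EFin; rewrite indicE.
case: (boolP (w \in D)) => [/set_mem wD|/negP wD] /=.
  rewrite big_seq big1// => i is_; rewrite indicE mem_set//; exact: (wD i).
have [/allP h|/allPn[i is_ nV]] := boolP (all (fun i => C (A i) w \in V i) s).
  by exfalso; apply/wD/mem_set => i /h /set_mem.
by rewrite (big_rem i)//= indicE (negPf nV) mul0r.
Qed.

Theorem success_poisson_process :
  poisson_process P C `[0, 1] (rate theta q).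
Proof.
split.
- by move=> t; rewrite /= in_itv /= => /andP[t0 _]; exact: rate_ge0.
- exact: integrable_rate.
- by move=> A mA _; exact: measurable_success_count.
- by move=> A mA A01 n m; rewrite count_law.
- by move=> A; exact: count_independent.
Qed.
End PoissonLaw.

(** * Independence of the history *)
Lemma filter_prefix (T : Type) (p : pred T) (l : seq T) :
  pairwise (fun x y => p y ==> p x) l -> seq.filter p l = take (count p l) l.
Proof.
elim: l => [//|x l IHl] /= /andP[xl /IHl ->]; case: ifP => px; first by rewrite add1n.
suff c0 : count p l = 0%N by rewrite c0 take0.
apply/eqP; rewrite -leqn0 leqNgt -has_count; apply/negP => pl.
elim: l xl pl {IHl} => [//|y l IHl] /= /andP[yx yl] /orP[py|//].
  by move: yx; rewrite py px.
exact: IHl.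
Qed.

Lemma nth_filter_prefix (T : Type) x0 (p : pred T) (l : seq T) k :
  pairwise (fun x y => p y ==> p x) l -> (k < size (seq.filter p l))%N ->
  nth x0 (seq.filter p l) k = nth x0 l k.
Proof. by move=> pl; rewrite size_filter filter_prefix// => kc; rewrite nth_take. Qed.

Lemma size_filter_prefix (T : Type) x0 (p : pred T) (l : seq T) k :
  pairwise (fun x y => p y ==> p x) l -> (k < size l)%N ->
  (k < size (seq.filter p l))%N = p (nth x0 l k).
Proof.
move=> pl kl; apply/idP/idP => [kf|pk].
  by rewrite -(nth_filter_prefix x0 pl kf); exact: (all_nthP x0 (filter_all p l)).
rewrite size_filter -(cat_take_drop k.+1 l) count_cat.
suff -> : count p (take k.+1 l) = k.+1 by rewrite ltn_addr.
have /eqP -> : count p (take k.+1 l) == size (take k.+1 l).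
  rewrite -all_count; apply/(all_nthP x0) => i; rewrite size_takel// ltnS => ik.
  rewrite nth_take//; move: ik; rewrite leq_eqVlt => /predU1P[->//|ik].
  by have /(pairwiseP x0) /(_ i k (ltn_trans ik kl) kl ik) := pl; rewrite pk.
by rewrite size_takel.
Qed.

Section History.
Context d (T : measurableType d) (R : realType) (P : probability T R).
Variables (N : {RV P >-> nat}) (U : nat -> {RV P >-> R}) (B : nat -> {RV P >-> bool}).

(** For a grid with maximum [t] these are the trials up to time [t], located
    within the precision of the grid. *)
Definition past (S : seq R) w := past_trials (size S) (trials N U B S w).

Lemma cell_past (S : seq R) (t x : R) : t \in S -> {in S, forall s, s <= t} ->
  (cell S x < size S)%N = (x <= t).
Proof.
move=> tS St; rewrite ltn_neqAle count_size andbT -all_count.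
apply/idP/idP => [/allPn[s sS]|xt]; first by rewrite -leNgt => /le_trans; apply; exact: St.
by apply/allPn; exists t => //; rewrite -leNgt.
Qed.

Lemma past_prefix (S : seq R) w :
  pairwise (fun x y : nat * bool => (y.1 < size S)%N ==> (x.1 < size S)%N) (trials N U B S w).
Proof.
apply/(pairwiseP (0%N, false)) => i j; rewrite !inE size_trials => iN jN ij.
rewrite !nth_trials//=; apply/implyP; apply: leq_ltn_trans; apply: cell_homo.
by apply: epoch_homo; rewrite (ltnW ij).
Qed.

Lemma size_past (S : seq R) t w k : t \in S -> {in S, forall s, s <= t} ->
  (k < size (past S w))%N = (k < N w)%N && (epoch N U k w <= t).
Proof.
move=> tS St; have [kN|Nk] /= := ltnP k (N w); last first.
  apply/negbTE; rewrite -leqNgt; apply: leq_trans Nk.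
  by rewrite -(size_trials N U B S) /past /past_trials size_filter count_size.
rewrite (size_filter_prefix (0%N, false) (past_prefix S w)) ?size_trials//.
by rewrite nth_trials// (cell_past _ tS St).
Qed.

Lemma nth_past (S : seq R) x0 w k : (k < size (past S w))%N -> (k < N w)%N ->
  nth x0 (past S w) k = (cell S (epoch N U k w), B k w).
Proof. by move=> ks kN; rewrite (nth_filter_prefix _ (past_prefix S w))// nth_trials. Qed.

(** The past determines the trials up to [t], so that equality of pasts can be
    used as an indiscernibility relation between sample points. *)
Lemma past_eqP (S : seq R) t w w' : t \in S -> {in S, forall s, s <= t} ->
  past S w = past S w' -> forall k, (k < N w)%N -> epoch N U k w <= t ->
  [/\ (k < N w')%N, epoch N U k w' <= t, B k w' = B k w &
      cell S (epoch N U k w') = cell S (epoch N U k w)].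
Proof.
move=> tS St e k kN kt.
have ks : (k < size (past S w))%N by rewrite (size_past _ _ tS St) kN.
have := ks; rewrite e (size_past _ _ tS St) => /andP[kN' kt'].
have h := nth_past (0%N, false) ks kN; rewrite e in ks h.
by move: h; rewrite nth_past// => -[e1 e2]; split.
Qed.

(** The events decided by the trials up to [t] as seen on some finite grid: the
    pi-system on which independence is checked. *)
Definition grid_event t : set (set T) := [set A | exists S,
  {in S, forall s, s <= t} /\
  forall w w', past (t :: S) w = past (t :: S) w' -> A w -> A w'].

Lemma cell_subseq (S S' : seq R) x y : {subset S <= S'} ->
  cell S' x = cell S' y -> cell S x = cell S y.
Proof.
move=> SS' /cell_eq e; apply: eq_in_count => s sS.
by rewrite !ltNge e//; exact: SS'.
Qed.

(** Finer grids distinguish more. *)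
Lemma past_subseq (S S' : seq R) t w w' : t \in S -> {subset S <= S'} ->
  {in S', forall s, s <= t} -> past S' w = past S' w' -> past S w = past S w'.
Proof.
move=> tS SS' S't e; have tS' := SS' _ tS.
have St : {in S, forall s, s <= t} by move=> s /SS'/S't.
have ss : size (past S w) = size (past S w').
  have szE S0 w0 : t \in S0 -> {in S0, forall s, s <= t} -> forall S1, t \in S1 ->
      {in S1, forall s, s <= t} -> size (past S0 w0) = size (past S1 w0).
    move=> t0 h0 S1 t1 h1; apply/eqP; rewrite eqn_leq; apply/andP; split;
    rewrite leqNgt; apply/negP => h; have := h.
      by rewrite (size_past _ _ t0 h0) -(size_past _ _ t1 h1) ltnn.
    by rewrite (size_past _ _ t1 h1) -(size_past _ _ t0 h0) ltnn.
  by rewrite (szE S w tS St S' tS' S't) e (szE S' w' tS' S't S tS St).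
apply: (@eq_from_nth _ (0%N, false)) => // k kw.
have kw' := kw; rewrite ss in kw'.
have := kw; rewrite (size_past _ _ tS St) => /andP[kN kt].
have [kN' kt' Bk ck] := past_eqP tS' S't e kN kt.
by rewrite !nth_past// Bk (cell_subseq SS' ck).
Qed.

(** The union of the two grids serves for the intersection. *)
Lemma grid_event_setI t : setI_closed (grid_event t).
Proof.
move=> A A' [S [St SA]] [S' [St' SA']]; exists (S ++ S'); split.
  by move=> s; rewrite mem_cat => /orP[/St|/St'].
have h : {in t :: S ++ S', forall s, s <= t}.
  by move=> s; rewrite inE mem_cat => /predU1P[->|/orP[/St|/St']].
move=> w w' e [Aw A'w]; split.
  apply: SA Aw; apply: past_subseq h e; first by rewrite inE eqxx.
  by move=> s; rewrite !inE mem_cat => /orP[->|->] //; rewrite orbT.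
apply: SA' A'w; apply: past_subseq h e; first by rewrite inE eqxx.
by move=> s; rewrite !inE mem_cat => /orP[->|->] //; rewrite !orbT.
Qed.

Lemma history_grid_event t : history N U B t `<=` <<s grid_event t >>.
Proof.
apply: smallest_sub; first exact: smallest_sigma_algebra.
move=> A [k [s [/andP[_ st] h]]]; apply: sub_sigma_algebra.
have St : {in [:: t; s], forall s, s <= t}.
  by move=> s'; rewrite !inE => /orP[/eqP->|/eqP->].
have tS : t \in [:: t; s] by rewrite inE eqxx.
exists [:: s]; split; first by move=> s' s's; apply: St; rewrite inE s's orbT.
move=> w w' e.
have key : (k < N w)%N -> epoch N U k w <= s ->
    [/\ (k < N w')%N, epoch N U k w' <= s & B k w' = B k w].
  move=> kN ks; have [kN' _ Bk /cell_eq ck] := past_eqP tS St e kN (le_trans ks st).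
  by split => //; rewrite ck// !inE eqxx orbT.
case: h => ->.
  by move=> [kN ks]; have [] := key kN ks.
by move=> [kN ks Bk]; have [kN' ks' e'] := key kN ks; split => //; rewrite e'.
Qed.

Section Independence.
Variables (theta q : R).
Hypothesis theta_gt0 : 0 < theta.
Hypothesis q01 : 0 < q < 1.
Hypothesis model : trials_model (negative_binomial_pmf theta q)
               (fun k => theta / (theta + k%:R - 1)) N U B.

Definition no_success t s : set T := [set w | success_count N U B `]t, s] w = 0%N].

Lemma measurable_no_success t s : measurable (no_success t s).
Proof.
have mC := measurable_success_count N U B (measurable_itv `]t, s]).
by have := mC measurableT [set 0%N]; rewrite setTI; apply.
Qed.

Definition no_success_prob t s : R := expR (- (hazard theta q t - hazard theta q s)).

(** [expectation_past_future] for the grid extended by [s]: the cell after [t] is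
    then the interval from [t] to [s], and the weight that vanishes on that cell
    and is 1 beyond it is the indicator of having no success there. *)
Lemma grid_event_indep t s A : t <= s -> grid_event t A ->
  measurable A /\
  (P (A `&` no_success t s) = P A * (no_success_prob t s)%:E)%E.
Proof.
move=> ts [S0 [S0t SA]].
pose S := sort <=%O (t :: S0); pose n := size S; pose S2 := rcons S s.
have nE : n = (size S0).+1 by rewrite /n size_sort.
have sortS : sorted <=%O S by exact: sort_le_sorted.
have cS : cell S = cell (t :: S0) by apply: cell_perm; rewrite perm_sort.
have tS : t \in S by rewrite mem_sort inE eqxx.
have St : {in S, forall x, x <= t}.
  by move=> x; rewrite mem_sort inE => /predU1P[->//|/S0t].
have cS2 x : cell S2 x = (cell S x + (s < x)%R)%N.
  by rewrite /S2 -cats1 cell_cat /= addn0.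
have cSn x : t < x -> cell S x = n.
  move=> tx; apply/eqP; rewrite eqn_leq count_size leqNgt.
  by rewrite (cell_past _ tS St) -ltNge.
have sx_past x : x <= t -> (s < x) = false.
  by move=> xt; apply/negbTE; rewrite -leNgt (le_trans xt).
have past2 x : (cell S2 x < n)%N = (x <= t).
  have [xt|tx] := leP x t; rewrite cS2.
    by rewrite sx_past// addn0 (cell_past _ tS St).
  by rewrite cSn// ltnNge leq_addr.
have next2 x : (cell S2 x == n) = (x \in `]t, s]%classic).
  apply/idP/idP => [/eqP e|].
    apply/mem_set; rewrite /= in_itv /=.
    have tx : t < x by rewrite ltNge -past2 e ltnn.
    by move: e; rewrite cS2 cSn// tx leNgt; case: (s < x) => // /eqP; rewrite addn1 gtn_eqF.
  move/set_mem; rewrite /= in_itv /= => /andP[tx xs].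
  by rewrite cS2 cSn// ltNge xs addn0.
(* [A] as a predicate on the observed past. *)
pose Q l := `[< exists2 w, past (t :: S0) w = l & A w >].
have pastE w : past_trials n (trials N U B S2 w) = past (t :: S0) w.
  rewrite /past (_ : size (t :: S0) = n) ?nE// -nE /past_trials /trials -cS !filter_map.
  have eqp : (preim (fun k => (cell S2 (epoch N U k w), B k w)) (fun x => (x.1 < n)%N)) =1
      preim (fun k => (cell S (epoch N U k w), B k w)) (fun x => (x.1 < n)%N).
    by move=> k; rewrite /preim /= past2 (cell_past _ tS St).
  have := eq_filter eqp (iota 0 (N w)) => ->; apply/eq_in_map => k; rewrite mem_filter => /andP[+ _].
  by rewrite /= (cell_past _ tS St) => kt; rewrite cS2 sx_past// addn0.
have AQ w : (w \in A) = Q (past (t :: S0) w).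
  apply/idP/idP => [/set_mem Aw|/asboolP[w' e Aw']]; first by apply/asboolP; exists w.
  by apply/mem_set; exact: SA e Aw'.
have AE : A = [set w | Q (past_trials n (trials N U B S2 w))].
  apply/seteqP; split => w; rewrite /= pastE -AQ; first exact: mem_set.
  exact: set_mem.
have mA : measurable A.
  rewrite AE; exact: (measurable_trials N U B S2 (fun z => Q (past_trials n z))).
split=> //; pose phi i : R := (i != n)%:R.
have weightE w : future_weight n phi Q (trials N U B S2 w) = \1_(A `&` no_success t s) w.
  have cE : success_count N U B `]t, s] w =
      count (fun x : nat * bool => (x.1 == n) && x.2) (trials N U B S2 w).
    rewrite /success_count /success_epochs /trials !count_map count_filter.
    by apply: eq_count => k /=; rewrite next2.
  have prodE (z : seq (nat * bool)) : \prod_(x <- z | (n <= x.1)%N && x.2) phi x.1 =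
      (count (fun x : nat * bool => (x.1 == n) && x.2) z == 0%N)%:R.
    elim: z => [|[c b] z IHz]; first by rewrite big_nil.
    rewrite big_cons /= IHz /phi; case: b; rewrite ?andbF ?add0n//= !andbT.
    have [->|cn] := eqVneq c n; first by rewrite leqnn mul0r add1n.
    by rewrite add0n mul1r; case: ifP.
  rewrite /future_weight pastE -AQ indicE in_setI prodE -cE.
  rewrite [w \in no_success t s](_ : _ = (success_count N U B `]t, s] w == 0%N)).
    by case: (w \in A); rewrite ?mul1r ?mul0r.
  by apply/idP/eqP => [/set_mem|h]; [|exact/mem_set].
have mD : measurable (A `&` no_success t s).
  by apply: measurableI => //; exact: measurable_no_success.
have -> : P (A `&` no_success t s) =
    (\int[P]_w (future_weight n phi Q (trials N U B S2 w))%:E)%E.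
  have := integral_indic P measurableT mD; rewrite setIT => <-.
  by apply: eq_integral => w _; rewrite weightE.
have sortS2 : sorted <=%O S2.
  rewrite /S2 -cats1 (sorted_pairwise le_trans) pairwise_cat -(sorted_pairwise le_trans).
  rewrite sortS /= andbT allrel1r; apply/allP => x xS.
  exact: le_trans (St _ xS) ts.
rewrite (expectation_past_future theta_gt0 q01 model sortS2); first last.
- by move=> i; rewrite /phi.
- by rewrite /S2 size_rcons -/n leqW// leqW.
rewrite -AE muleC; congr (_ * (expR _)%:E)%E.
rewrite /S2 size_rcons -/n big_nat_recr ?leqW//= big_nat1.
have bd_t : bd S2 n = t.
  rewrite /bd nE /= /S2 nth_rcons -/n nE leqnn.
  apply/le_anti/andP; split; first by apply: St; rewrite mem_nth// -/n nE.
  have := tS => /(nthP 2)[k kn <-].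
  have S0n : (size S0 < size S)%N by rewrite -/n nE.
  apply: (le_sorted_leq_nth 2 sortS); [exact: kn|exact: S0n|].
  by move: kn; rewrite -/n nE ltnS.
have bd_s : bd S2 n.+1 = s by rewrite /bd /= /S2 nth_rcons -/n ltnn eqxx.
by rewrite bd_t bd_s /phi eqxx gtn_eqF// subr0 subrr mul0r addr0 mul1r.
Qed.

(** Dynkin's lemma extends independence from the grid events to the sigma-algebra
    they generate, which contains the history. *)
Theorem history_independent t s A : t <= s -> history N U B t A ->
  measurable A /\
  (P (A `&` no_success t s) = P A * (no_success_prob t s)%:E)%E.
Proof.
move=> ts /history_grid_event; set e := (no_success_prob t s)%:E.
pose D := no_success t s; have mD : measurable D by exact: measurable_no_success.
pose H := [set A | measurable A /\ (P (A `&` D) = P A * e)%E].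
suff : <<s grid_event t >> `<=` H by apply.
have GH : grid_event t `<=` H by move=> A'; exact: grid_event_indep.
apply: (lambda_system_subset (@grid_event_setI t)) => //.
apply/dynkin_lambda_system; split.
- by apply: GH; exists [::].
- move=> A' [mA' PA']; split; first exact: measurableC.
  have [_ PT] : H setT by apply: GH; exists [::].
  rewrite setTI probability_setT mul1e in PT.
  have -> : ~` A' `&` D = D `\` A' by rewrite setDE setIC.
  have -> : P (D `\` A') = (P D - P (D `&` A'))%E.
    by apply: measureD => //; rewrite (le_lt_trans (probability_le1 P mD))// ltry.
  have PA : P A' \is a fin_num by rewrite fin_num_measure.
  rewrite setIC PA' PT.
  rewrite probability_setC// -(fineK PA) /e -EFinM -!EFinB -EFinM; congr EFin; ring.
- move=> F tF HF; have mF k : measurable (F k) by case: (HF k).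
  split; first exact: bigcupT_measurable.
  have tFD : trivIset setT (fun k => F k `&` D).
    by move=> i j _ _ [w [[Fi _] [Fj _]]]; apply: tF => //; exists w.
  rewrite setI_bigcupl measure_bigcup//; last by move=> k _; exact: measurableI.
  rewrite measure_bigcup// muleC /e -nneseriesZl//.
  by apply: eq_eseriesr => k _; have [_ h] := HF k; rewrite [RHS]muleC; exact: h.
Qed.
End Independence.
End History.

(** * The discrete last-success problem *)
Section LastSuccessValue.
Variable R : realType.
Implicit Types (u h : R).

(** The maximum over [0 <= s <= u] of [s * exp (- s)], the probability that a
    Poisson variable with mean [s] is 1. *)
Definition last_success_value u : R := if u <= 1 then u * expR (- u) else expR (-1).

Lemma last_success_value_ge u s : 0 <= s <= u -> s * expR (- s) <= last_success_value u.
Proof.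
move=> /andP[s0 su]; rewrite /last_success_value; case: ifPn => u1; last first.
  rewrite -ler_pdivlMr ?expR_gt0// -expRN -expRD opprK.
  by apply: le_trans (expR_ge1Dx (-1 + s)); rewrite addrA subrr add0r.
have us0 : 0 <= u - s by rewrite subr_ge0.
rewrite -ler_pdivlMr ?expR_gt0// -expRN -mulrA -expRD opprK.
have u0 : 0 <= u by exact: le_trans su.
have := expR_ge1Dx (- u + s) => h.
have h' : u * (1 + (- u + s)) <= u * expR (- u + s) by exact: ler_wpM2l.
apply: le_trans h'; rewrite -subr_ge0.
have -> : u * (1 + (- u + s)) - s = (1 - u) * (u - s) by ring.
by rewrite mulr_ge0// subr_ge0.
Qed.

(** The optimal probability of stopping on the last success among [m] independent
    trials with failure probability [rho]: the recursion is
    [v (m + 1) = rho * v m + (1 - rho) * max (rho ^ m) (v m)]. *)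
Fixpoint odds_value (rho : R) m : R :=
  if m is m'.+1 then
    odds_value rho m' + (1 - rho) * Num.max (rho ^+ m' - odds_value rho m') 0
  else 0.

Lemma odds_value_ge0 rho m : rho <= 1 -> 0 <= odds_value rho m.
Proof.
move=> r1; elim: m => [//|m IHm] /=; rewrite addr_ge0// mulr_ge0 ?subr_ge0//.
by rewrite le_max lexx orbT.
Qed.

(** As long as stopping at a success is better than going on, the value is
    [m * (1 - rho) * rho ^ (m - 1)], the probability of a single success; from
    then on it stays constant. *)
Lemma odds_value_le h n m : 0 <= h -> (m <= n)%N ->
  odds_value (expR (- h)) m <= expR h * last_success_value (n%:R * h).
Proof.
move=> h0; set rho := expR (- h); set V := _ * _.
have rho0 : 0 < rho by exact: expR_gt0.
have rho1 : rho <= 1 by rewrite /rho -expR0 ler_expR oppr_le0.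
have rh : 1 - rho <= h.
  by have := expR_ge1Dx (- h); rewrite -/rho; lra.
have rhoX k : rho ^+ k = expR (- (k%:R * h)).
  by rewrite /rho -expRM_natl mulrN.
have regime1 k : (k <= n)%N -> rho * odds_value rho k = k%:R * (1 - rho) * rho ^+ k ->
    odds_value rho k <= V.
  move=> kn e; rewrite -(ler_pM2l rho0) e /V mulrA /rho -expRD addNr expR0 mul1r -/rho.
  apply: (@le_trans _ _ (k%:R * h * expR (- (k%:R * h)))).
    by rewrite rhoX ler_wpM2r ?expR_ge0// ler_wpM2l.
  apply: last_success_value_ge; rewrite mulr_ge0//=.
  by rewrite ler_wpM2r// ler_nat.
suff : (m <= n)%N -> odds_value rho m <= V /\
   (rho * odds_value rho m = m%:R * (1 - rho) * rho ^+ m \/ rho ^+ m <= odds_value rho m).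
  by move=> H /H[].
elim: m => [_|m IHm mn].
  have e : rho * odds_value rho 0 = 0%:R * (1 - rho) * rho ^+ 0 by rewrite /= mulr0 !mul0r.
  by split; [exact: regime1|left].
have [vV reg] := IHm (ltnW mn).
have [small|big] := leP (rho ^+ m) (odds_value rho m).
  have e : odds_value rho m.+1 = odds_value rho m.
    by rewrite /= max_r ?mulr0 ?addr0// subr_le0.
  rewrite e; split => //; right; apply: le_trans small.
  by rewrite exprS ler_piMl// exprn_ge0// ltW.
have {reg} e : rho * odds_value rho m = m%:R * (1 - rho) * rho ^+ m.
  by case: reg => // h1; move: (lt_le_trans big h1); rewrite ltxx.
have e' : rho * odds_value rho m.+1 = m.+1%:R * (1 - rho) * rho ^+ m.+1.
  rewrite /= max_l; last by rewrite subr_ge0 ltW.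
  rewrite exprS -natr1 mulrDr e; move: e; move: (odds_value rho m) (rho ^+ m) => v y e.
  have -> : rho * ((1 - rho) * (y - v)) = (1 - rho) * (rho * y - rho * v) by ring.
  by rewrite e; ring.
by split; [exact: regime1|left].
Qed.

(** Weak linear programming duality.  For the stopping problem, [x m] is the
    probability of stopping at a success in cell [m], counted from the end, and
    [y m] that of not having stopped before the last [m] cells; [odds_value] is
    the dual certificate. *)
Lemma odds_value_dual (rho : R) (x y : nat -> R) n : 0 <= rho <= 1 ->
  (forall m, 0 <= x m) -> 0 <= y 0%N ->
  (forall m, (m < n)%N -> x m <= y m.+1 - y m) ->
  (forall m, (m < n)%N -> x m <= (1 - rho) * y m.+1) ->
  \sum_(m < n) x m * rho ^+ m <= odds_value rho n * y n.
Proof.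
move=> /andP[rho0 rho1] x0 y0; elim: n => [_ _|n IHn xy1 xy2].
  by rewrite big_ord0 /= mul0r.
rewrite big_ord_recr /=.
have {}IHn : \sum_(m < n) x m * rho ^+ m <= odds_value rho n * y n.
  by apply: IHn => m mn; [apply: xy1|apply: xy2]; exact: leqW.
have := xy1 n (ltnSn n); have := xy2 n (ltnSn n) => h2 h1.
have v0 := odds_value_ge0 n rho1.
have hv : odds_value rho n * y n <= odds_value rho n * (y n.+1 - x n).
  by apply: ler_wpM2l => //; lra.
apply: (le_trans (lerD IHn (lexx _))); apply: (le_trans (lerD hv (lexx _))).
have [small|big] := leP (rho ^+ n) (odds_value rho n).
  rewrite max_r ?subr_le0// mulr0 addr0.
  have : (rho ^+ n - odds_value rho n) * x n <= 0.
    by apply: mulr_le0_ge0 => //; rewrite subr_le0.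
  by move: (rho ^+ n) (odds_value rho n) (y n.+1) (x n); clear => *; nra.
rewrite max_l; last by rewrite subr_ge0 ltW.
have : (rho ^+ n - odds_value rho n) * x n <=
    (rho ^+ n - odds_value rho n) * ((1 - rho) * y n.+1).
  by apply: ler_wpM2l => //; rewrite subr_ge0 ltW.
by move: (rho ^+ n) (odds_value rho n) (y n.+1) (x n) => a b c e; clear => *; nra.
Qed.

Lemma le_expR_div (p V u : R) : 0 <= V ->
  (forall n, p <= expR (u / n.+1%:R) * V) -> p <= V.
Proof.
move=> V0 pV.
have c0 : (fun n => u * (n.+1%:R)^-1) @ \oo --> u * (0 : R).
  by apply: cvgM; [exact: cvg_cst|exact: cvg_harmonic].
have c1 : (fun n => expR (u * (n.+1%:R)^-1)) @ \oo --> expR (u * (0 : R)).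
  by apply: continuous_cvg c0; exact: continuous_expR.
have cv : (fun n => expR (u / n.+1%:R) * V) @ \oo --> expR (u * (0 : R)) * V.
  by apply: cvgM c1 _; exact: cvg_cst.
rewrite mulr0 expR0 mul1r in cv.
rewrite -(cvg_lim (@Rhausdorff R) cv); apply: limr_ge; first by apply/cvg_ex; exists V.
exact: nearW.
Qed.
End LastSuccessValue.

(** * Events of the history *)
Section HistoryEvents.
Context d (T : measurableType d) (R : realType) (P : probability T R).
Variables (N : {RV P >-> nat}) (U : nat -> {RV P >-> R}) (B : nat -> {RV P >-> bool}).

Lemma historyC t A : history N U B t A -> history N U B t (~` A).
Proof.
have [_ hC _] := smallest_sigma_algebra [set: T] _ : sigma_algebra setT (history N U B t).
by move=> /hC; rewrite setTD.
Qed.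

Lemma history_bigcup t (A : nat -> set T) :
  (forall n, history N U B t (A n)) -> history N U B t (\bigcup_n A n).
Proof.
have [_ _ hU] := smallest_sigma_algebra [set: T] _ : sigma_algebra setT (history N U B t).
exact: hU.
Qed.

Lemma history0 t : history N U B t set0.
Proof. by have [] := smallest_sigma_algebra [set: T] _ : sigma_algebra setT (history N U B t). Qed.

Lemma historyT t : history N U B t setT.
Proof. by rewrite -setC0; apply: historyC; exact: history0. Qed.

Lemma historyU t A A' : history N U B t A -> history N U B t A' ->
  history N U B t (A `|` A').
Proof.
move=> hA hA'; rewrite -bigcup2E; apply: history_bigcup => -[|[|n]] //=.
exact: history0.
Qed.

Lemma historyI t A A' : history N U B t A -> history N U B t A' ->
  history N U B t (A `&` A').
Proof.
by move=> hA hA'; rewrite -[_ `&` _]setCK setCI; apply: historyC; apply: historyU; exact: historyC.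
Qed.

Lemma historyD t A A' : history N U B t A -> history N U B t A' ->
  history N U B t (A `\` A').
Proof. by move=> hA hA'; rewrite setDE; apply: historyI => //; exact: historyC. Qed.

Lemma history_trial t s k : 0 <= s <= t ->
  history N U B t [set w | (k < N w)%N /\ epoch N U k w <= s].
Proof. by move=> st; apply: sub_sigma_algebra; exists k, s; split => //; left. Qed.

Lemma history_success t s k : 0 <= s <= t ->
  history N U B t [set w | [/\ (k < N w)%N, epoch N U k w <= s & B k w]].
Proof. by move=> st; apply: sub_sigma_algebra; exists k, s; split => //; right. Qed.

Lemma history_le s t A : s <= t -> history N U B s A -> history N U B t A.
Proof.
move=> st; apply: smallest_sub; first exact: smallest_sigma_algebra.
move=> A' [k [x [/andP[x0 xs] h]]]; apply: sub_sigma_algebra.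
by exists k, x; rewrite x0 (le_trans xs).
Qed.

Lemma history_measurable t A : history N U B t A -> measurable A.
Proof.
apply: smallest_sub; first exact: sigma_algebra_measurable.
have mN k : measurable [set w | (k < N w)%N].
  by have := measurable_funP N measurableT [set n | (k < n)%N]; rewrite setTI; apply.
have mE k s : measurable [set w | epoch N U k w <= s].
  have := measurable_epoch N U k measurableT (measurable_itv `]-oo, s]).
  by rewrite setTI preimage_itvNyc.
have mB k : measurable [set w | B k w].
  by have := measurable_funP (B k) measurableT [set true]; rewrite setTI; apply.
move=> A' [k [s [_ [->|->]]]].
  exact: measurableI (mN k) (mE k s).
rewrite (_ : [set w | _] = [set w | (k < N w)%N] `&` [set w | epoch N U k w <= s] `&`
  [set w | B k w]); first by apply: measurableI => //; exact: measurableI.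
by apply/seteqP; split => w; [case=> ? ? ?|case=> -[]].
Qed.

Lemma success_epochP w (x : R) : (x \in success_epochs N U B w) <->
  exists k, [/\ (k < N w)%N, B k w & x = epoch N U k w].
Proof.
split=> [/mapP[k]|[k [kN Bk ->]]].
  by rewrite mem_filter mem_iota add0n => /andP[Bk /= kN] ->; exists k.
by apply/mapP; exists k; rewrite // mem_filter mem_iota Bk.
Qed.

Lemma no_successP t s w : no_success N U B t s w <->
  forall k, (k < N w)%N -> B k w -> ~ (t < epoch N U k w <= s).
Proof.
rewrite /no_success /= /success_count; split.
  move=> /eqP; rewrite -leqn0 leqNgt -has_count => /hasPn h k kN Bk ts.
  have /h/negP : epoch N U k w \in success_epochs N U B w by apply/success_epochP; exists k.
  by apply; apply/mem_set; rewrite /= in_itv.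
move=> h; apply/eqP; rewrite -leqn0 leqNgt -has_count; apply/negP => /hasP[x].
by move=> /success_epochP[k [kN Bk ->]] /set_mem; rewrite /= in_itv /=; exact: h.
Qed.

Hypothesis U01 : forall i w, 0 <= U i w <= 1.

Lemma epoch_01 k w : (k < N w)%N -> 0 <= epoch N U k w <= 1.
Proof.
move=> kN; have : epoch N U k w \in sort <=%O [seq U i w | i <- iota 0 (N w)].
  by apply: mem_nth; rewrite size_sort size_map size_iota.
by rewrite mem_sort => /mapP[i _ ->].
Qed.

(** The generators have [0 <= s]; for negative [s] the event is empty since the
    epochs are nonnegative. *)
Lemma history_before t s k : s <= t ->
  history N U B t [set w | (k < N w)%N /\ epoch N U k w <= s].
Proof.
move=> st; have [s0|s0] := leP 0 s; first by apply: history_trial; rewrite s0.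
rewrite (_ : [set w | _] = set0); first exact: history0.
apply/seteqP; split => // w [kN]; have /andP[e0 _] := epoch_01 kN.
by rewrite leNgt (lt_le_trans s0).
Qed.

Lemma history_success_in t s s' k : s' <= t ->
  history N U B t [set w | [/\ (k < N w)%N, B k w & s < epoch N U k w <= s']].
Proof.
move=> st; have [s0|s0] := leP 0 s'; last first.
  rewrite (_ : [set w | _] = set0); first exact: history0.
  apply/seteqP; split => // w [kN _ /andP[_]]; have /andP[e0 _] := epoch_01 kN.
  by rewrite leNgt (lt_le_trans s0).
have [ss'|s's] := leP s s'; last first.
  rewrite (_ : [set w | _] = set0); first exact: history0.
  by apply/seteqP; split => // w [kN _ /andP[h1 h2]]; move: (lt_trans s's h1); rewrite ltNge h2.
rewrite (_ : [set w | _] = [set w | [/\ (k < N w)%N, epoch N U k w <= s' & B k w]] `\`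
    [set w | (k < N w)%N /\ epoch N U k w <= s]).
  apply: historyD; first by apply: history_success; rewrite s0.
  by apply: history_before; exact: le_trans st.
apply/seteqP; split => w /=.
  by move=> [kN Bk /andP[h1 h2]]; split=> // -[_]; rewrite leNgt h1.
by move=> [[kN h2 Bk] /not_andP[//|/negP]]; rewrite -ltNge => h1; rewrite h1 h2.
Qed.

Lemma history_no_success t s : history N U B s (no_success N U B t s).
Proof.
rewrite -[no_success _ _ _ _ _]setCK; apply: historyC.
rewrite (_ : ~` _ = \bigcup_k [set w | [/\ (k < N w)%N, B k w & t < epoch N U k w <= s]]).
  by apply: history_bigcup => k; exact: history_success_in.
apply/seteqP; split => w.
  apply: contra_notP => h; apply/no_successP => k kN Bk ts; apply: h; by exists k.
by move=> [k _ [kN Bk ts]] /no_successP /(_ k kN Bk).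
Qed.

Lemma winning_measurable tau : measurable_fun setT tau ->
  measurable (winning_event N U B tau).
Proof.
move=> mtau.
have mN k : measurable [set w | (k < N w)%N].
  by have := measurable_funP N measurableT [set n | (k < n)%N]; rewrite setTI; apply.
have mB k : measurable [set w | B k w].
  by have := measurable_funP (B k) measurableT [set true]; rewrite setTI; apply.
have mE k : measurable [set w | tau w = epoch N U k w].
  have := measurable_fun_eqr mtau (measurable_epoch N U k) measurableT (Y := [set true]).
  rewrite setTI => /(_ I); congr measurable; apply/seteqP; split => w /=; first by move/eqP.
  by move=> ->; rewrite eqxx.
rewrite (_ : winning_event _ _ _ _ = \bigcup_k ([set w | (k < N w)%N] `&`
   [set w | tau w = epoch N U k w] `&` [set w | B k w] `&`
   \bigcap_(j in [set j | (k < j)%N]) (~` ([set w | (j < N w)%N] `&` [set w | B j w])))).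
  apply: bigcup_measurable => k _; apply: measurableI.
    by apply: measurableI => //; exact: measurableI.
  by apply: bigcap_measurableType => j _; apply: measurableC; exact: measurableI.
apply/seteqP; split => w.
  move=> [k [kN tk Bk h]]; exists k => //; split => //.
  by move=> j /= kj [jN Bj]; have := h j; rewrite kj jN Bj => /(_ isT).
move=> [k _ [[[kN tk] Bk] h]]; exists k; split => // j /andP[kj jN].
by apply/negP => Bj; exact: (h j kj).
Qed.
End HistoryEvents.

(** * The upper bound for every strategy *)
Section Optimality.
Context d (T : measurableType d) (R : realType) (P : probability T R).
Variables (theta q : R).
Variables (N : {RV P >-> nat}) (U : nat -> {RV P >-> R}) (B : nat -> {RV P >-> bool}).
Hypothesis theta_gt0 : 0 < theta.
Hypothesis q01 : 0 < q < 1.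
Hypothesis model : trials_model (negative_binomial_pmf theta q)
               (fun k => theta / (theta + k%:R - 1)) N U B.

Let U01 i w : 0 <= U i w <= 1 := uniform_range model i w.

Definition total_hazard : R := - theta * ln (1 - q).

Lemma total_hazard_gt0 : 0 < total_hazard.
Proof.
have /andP[q0 q1] := q01; rewrite /total_hazard mulNr oppr_gt0 pmulr_rlt0//.
by apply: ln_lt0; lra.
Qed.

Lemma hazard_le0 x : x <= 0 -> hazard theta q x = total_hazard.
Proof. by move=> x0; rewrite /hazard clip_lt0// subr0 mulr1. Qed.

(** The time at which the remaining integrated rate is [u]. *)
Definition hazard_time (u : R) : R := 1 - (1 - expR (- u / theta)) / q.

Lemma hazard_time_01 u : 0 <= u <= total_hazard -> 0 <= hazard_time u <= 1.
Proof.
move=> /andP[u0 uH]; have /andP[q0 q1] := q01.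
have e1 : expR (- u / theta) <= 1.
  by rewrite -expR0 ler_expR mulNr oppr_le0 divr_ge0// ltW.
have e2 : 1 - q <= expR (- u / theta).
  have -> : 1 - q = expR (- total_hazard / theta).
    rewrite (_ : - total_hazard / theta = ln (1 - q)) ?lnK ?posrE ?subr_gt0//.
    by rewrite /total_hazard; field; rewrite gt_eqF.
  by rewrite ler_expR ler_pM2r ?invr_gt0// lerN2.
rewrite /hazard_time; apply/andP; split.
  by rewrite subr_ge0 ler_pdivrMr// mul1r; lra.
by rewrite lerBlDr lerDl divr_ge0 ?(ltW q0)// subr_ge0.
Qed.

Lemma hazard_timeK u : 0 <= u <= total_hazard -> hazard theta q (hazard_time u) = u.
Proof.
move=> uH; have /andP[q0 q1] := q01.
rewrite /hazard clip_id ?hazard_time_01// /hazard_time.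
set e := expR (- u / theta).
rewrite (_ : 1 - q * (1 - (1 - (1 - e) / q)) = e); last by field; rewrite gt_eqF.
by rewrite expRK; field; rewrite gt_eqF.
Qed.

Section Strategy.
Variables (tau : T -> R) (n : nat).
Hypothesis strat : stopping_strategy N U B tau.
Let h : R := total_hazard / n.+1%:R.

(* The [m]-th grid point leaves an integrated rate of [m * h]; the earliest one
   is put before time 0 so that the half-open cells cover a stop at time 0. *)
Let s m : R := if m == n.+1 then -1 else hazard_time (m%:R * h).

Let h0 : 0 <= h.
Proof. by rewrite divr_ge0// ltW// total_hazard_gt0. Qed.

Let mh01 m : (m <= n.+1)%N -> 0 <= m%:R * h <= total_hazard.
Proof.
move=> mn; rewrite mulr_ge0//= /h mulrA ler_pdivrMr// mulrC.
by rewrite ler_wpM2l ?ler_nat// ltW// total_hazard_gt0.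
Qed.

Let hazard_s m : (m <= n.+1)%N -> hazard theta q (s m) = m%:R * h.
Proof.
move=> mn; rewrite /s; case: eqP => [->|_]; last by rewrite hazard_timeK// mh01.
by rewrite hazard_le0 ?lerN10// /h mulrCA divff ?mulr1.
Qed.

Let s_01 m : (m < n.+1)%N -> 0 <= s m <= 1.
Proof. by move=> mn; rewrite /s ltn_eqF// hazard_time_01// mh01// ltnW. Qed.

Let s_dec m : (m < n.+1)%N -> s m.+1 <= s m.
Proof.
move=> mn; rewrite {1}/s; case: eqP => [_|_].
  by have /andP[+ _] := s_01 mn; apply: le_trans; rewrite lerN10.
rewrite /s ltn_eqF// /hazard_time lerD2l lerN2 ler_pM2r ?invr_gt0; last by case/andP: q01.
by rewrite lerD2l lerN2 ler_expR ler_pM2r ?invr_gt0// lerN2 ler_wpM2r// ler_nat.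
Qed.

Let s0 : s 0 = 1.
Proof. by rewrite /s /= mul0r /hazard_time oppr0 mul0r expR0 subrr mul0r subr0. Qed.

(* Cell [m] is the interval from [s m.+1] (excluded) to [s m] (included). *)
Let after m : set T := [set w | s m < tau w].
Let stop_success m : set T :=
  (after m.+1 `\` after m) `\` no_success N U B (s m.+1) (s m).

Let mtau : measurable_fun setT tau := strategy_measurable strat.

Let tau_01 w : 0 <= tau w <= 1.
Proof.
have [->|[k kN ->]] := strategy_range strat w; first by rewrite ler01 lexx.
exact: epoch_01 U01 _ _ kN.
Qed.

Let history_after m : (m <= n.+1)%N -> history N U B (s m) (after m).
Proof.
rewrite leq_eqVlt => /predU1P[->|mn].
  rewrite (_ : after n.+1 = setT); first exact: historyT.
  apply/seteqP; split => // w _; rewrite /after /s eqxx /=.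
  by have /andP[t0 _] := tau_01 w; exact: lt_le_trans (ltrN10 R) t0.
rewrite (_ : after m = ~` [set w | tau w <= s m]).
  by apply: historyC; apply: strategy_adapted => //; exact: s_01.
apply/seteqP; split => w /=; rewrite /after /= ltNge; first by move/negP.
by move=> /negP.
Qed.

Let m_after m : (m <= n.+1)%N -> measurable (after m).
Proof. by move=> mn; exact: history_measurable (history_after mn). Qed.

Let history_stop_success m : (m < n.+1)%N -> history N U B (s m) (stop_success m).
Proof.
move=> mn; apply: historyD; last exact: history_no_success.
apply: historyD; last by apply: history_after; exact: ltnW.
by apply: history_le (s_dec mn) _; exact: history_after.
Qed.

Let m_stop_success m : (m < n.+1)%N -> measurable (stop_success m).
Proof. by move=> mn; exact: history_measurable (history_stop_success mn). Qed.

Let cell_win m : set T := stop_success m `&` no_success N U B (s m) 1.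

(* A win in cell [m] requires a success in that cell and none after it. *)
Let winning_sub : winning_event N U B tau `<=` \big[setU/set0]_(m < n.+1) cell_win m.
Proof.
move=> w [k [kN tk Bk later]]; rewrite -bigcup_mkord.
have [m mn stm] : exists2 m, (m < n.+1)%N & s m.+1 < tau w <= s m.
  have [m [mn tm mmin]] : exists m, [/\ (m <= n.+1)%N, s m < tau w &
      forall j, (j < m)%N -> tau w <= s j].
    pose p m := s m < tau w.
    have pn : exists m, p m.
      exists n.+1; rewrite /p /s eqxx; have /andP[t0 _] := tau_01 w.
      exact: lt_le_trans (ltrN10 R) t0.
    exists (ex_minn pn); case: ex_minnP => m pm mmin; split => //.
      apply: mmin; rewrite /p /s eqxx; have /andP[t0 _] := tau_01 w.
      exact: lt_le_trans (ltrN10 R) t0.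
    by move=> j jm; rewrite leNgt; apply/negP => pj; have := mmin j pj; rewrite leqNgt jm.
  case: m mn tm mmin => [_|m mn tm mmin].
    by rewrite s0 ltNge; have /andP[_ ->] := tau_01 w.
  by exists m => //; rewrite tm mmin.
exists m => //; have /andP[t1 t2] := stm; split.
  split; first by split; [exact: t1|rewrite /after /=; apply/negP; rewrite -leNgt].
  by move=> /no_successP /(_ k kN Bk); rewrite -tk stm.
apply/no_successP => j jN Bj /andP[sj _].
have kj : (k < j)%N.
  rewrite ltnNge; apply/negP => jk; move: sj; rewrite ltNge (le_trans _ t2)// tk.
  by apply: epoch_homo; rewrite jk.
by have := later j; rewrite kj jN Bj => /(_ isT).
Qed.

Let fineP A : measurable A -> P A = (fine (P A))%:E.
Proof. by move=> mA; rewrite fineK// fin_num_measure. Qed.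

Let m_after_S m : (m < n.+1)%N -> after m `<=` after m.+1.
Proof. by move=> mn w; exact: le_lt_trans (s_dec mn). Qed.

(** Relaxation to a linear program: of the strategy only the probabilities of
    reaching each cell and of stopping in it while it contains a success are kept,
    and the cell counts as won if no success follows it. *)
Lemma strategy_bound :
  (P (winning_event N U B tau) <=
   (expR (total_hazard / n.+1%:R) * last_success_value total_hazard)%:E)%E.
Proof.
pose rho := expR (- h).
have rho01 : 0 <= rho <= 1 by rewrite expR_ge0/= -expR0 ler_expR oppr_le0.
have m_cell m : (m < n.+1)%N -> measurable (cell_win m).
  by move=> mn; apply: measurableI; [exact: m_stop_success|exact: measurable_no_success].
have mW : measurable (winning_event N U B tau) by exact: winning_measurable.
have step1 : (P (winning_event N U B tau) <= \sum_(m < n.+1) P (cell_win m))%E.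
  apply: le_trans (Boole_inequality P m_cell).
  apply: le_measure winning_sub; rewrite inE//.
  by apply: bigsetU_measurable => i _; exact: m_cell.
(* The sequences are continued by 0 beyond the grid. *)
pose x m := if (m < n.+1)%N then fine (P (stop_success m)) else 0.
pose y m := if (m <= n.+1)%N then fine (P (after m)) else 0.
have xE (m : 'I_n.+1) : P (cell_win m) = (x m * rho ^+ m)%:E.
  have [_ ->] := history_independent theta_gt0 q01 model
    (proj2 (andP (s_01 (ltn_ord m)))) (history_stop_success (ltn_ord m)).
  rewrite /x ltn_ord EFinM -(fineP (m_stop_success (ltn_ord m))); congr (_ * _%:E)%E.
  rewrite /no_success_prob hazard_s 1?ltnW// /hazard clip_gt1// subrr mulr0 subr0 ln1.
  by rewrite mulr0 subr0 /rho -expRM_natl mulrN.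
apply: (le_trans step1); under eq_bigr do rewrite xE.
rewrite sumEFin lee_fin.
have yn : y n.+1 <= 1.
  by rewrite /y leqnn -lee_fin -(fineP (m_after (leqnn _))); apply: probability_le1; exact: m_after.
have diff m : (m < n.+1)%N -> P (after m.+1 `\` after m) = (y m.+1 - y m)%:E.
  move=> mn; rewrite /y mn (ltnW mn) EFinB -(fineP (m_after mn)) -(fineP (m_after (ltnW mn))).
  rewrite -[X in (_ - P X)%E](setIidr (m_after_S mn)).
  apply: measureD; [exact: m_after|exact/m_after/ltnW|].
  by apply: le_lt_trans (ltry 1); apply: probability_le1; exact: m_after.
have xy1 m : (m < n.+1)%N -> x m <= y m.+1 - y m.
  move=> mn; rewrite /x mn -lee_fin -(fineP (m_stop_success mn)) -diff//.
  apply: le_measure; rewrite ?inE; [exact: m_stop_success| |by move=> w []].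
  by apply: measurableD; apply: m_after => //; exact: ltnW.
(* Entering the cell is decided by the history before it, hence independent of
   whether the cell contains a success. *)
have xy2 m : (m < n.+1)%N -> x m <= (1 - rho) * y m.+1.
  move=> mn; have [mA PA] := history_independent theta_gt0 q01 model (s_dec mn)
    (history_after (m := m.+1) mn).
  have mN := measurable_no_success N U B (s m.+1) (s m).
  have rhoE : no_success_prob theta q (s m.+1) (s m) = rho.
    rewrite /no_success_prob !hazard_s// 1?ltnW// -natr1 /rho; congr expR; ring.
  have : (P (stop_success m) <= P (after m.+1 `\` no_success N U B (s m.+1) (s m)))%E.
    apply: le_measure; rewrite ?inE; [exact: m_stop_success|exact: measurableD|].
    by move=> w [[? _] ?].
  have -> : P (after m.+1 `\` no_success N U B (s m.+1) (s m)) =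
      (P (after m.+1) - P (after m.+1 `&` no_success N U B (s m.+1) (s m)))%E.
    by apply: measureD => //; apply: le_lt_trans (ltry 1); exact: probability_le1.
  rewrite PA rhoE (fineP mA) -EFinM -EFinB (fineP (m_stop_success mn)) lee_fin.
  by rewrite /x /y mn mulrBl mul1r (mulrC rho).
have x0 m : 0 <= x m by rewrite /x; case: ifP => // _; exact: fine_ge0.
have y0 : 0 <= y 0%N by rewrite /y; exact: fine_ge0.
apply: (le_trans (odds_value_dual rho01 x0 y0 xy1 xy2)).
have v0 : 0 <= odds_value rho n.+1 by apply: odds_value_ge0; case/andP: rho01.
apply: (@le_trans _ _ (odds_value rho n.+1)); first by rewrite ler_piMr.
have := odds_value_le h0 (leqnn n.+1); rewrite -/rho.
by rewrite /h [X in last_success_value X]mulrCA divff ?mulr1.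
Qed.
End Strategy.

Lemma last_success_value_ge0 (u : R) : 0 <= u -> 0 <= last_success_value u.
Proof. by move=> u0; rewrite /last_success_value; case: ifP => _; rewrite ?mulr_ge0 ?expR_ge0. Qed.

(** The factor in [strategy_bound] tends to 1 as the cells shrink. *)
Theorem strategy_upper_bound tau : stopping_strategy N U B tau ->
  (P (winning_event N U B tau) <= (last_success_value total_hazard)%:E)%E.
Proof.
move=> strat.
have mW := winning_measurable N U B (strategy_measurable strat).
have fW : P (winning_event N U B tau) \is a fin_num by rewrite fin_num_measure.
rewrite -(fineK fW) lee_fin; apply: (@le_expR_div _ _ _ total_hazard).
  by apply: last_success_value_ge0; rewrite ltW// total_hazard_gt0.
by move=> n; rewrite -lee_fin fineK//; exact: strategy_bound.
Qed.
End Optimality.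

(** * The threshold strategy *)
Section Threshold.
Context d (T : measurableType d) (R : realType) (P : probability T R).
Variables (N : {RV P >-> nat}) (U : nat -> {RV P >-> R}) (B : nat -> {RV P >-> bool}).
Hypothesis U01 : forall i w, 0 <= U i w <= 1.
Variable a : R.
Hypothesis a_ge0 : 0 <= a.
Let tau := threshold_strategy N U B a.

Lemma threshold_epochs w : [seq t <- success_epochs N U B w | a <= t] =
  [seq epoch N U k w | k <- iota 0 (N w) & B k w && (a <= epoch N U k w)].
Proof.
rewrite /success_epochs filter_map -filter_predI; congr map.
by apply: eq_filter => k /=; rewrite andbC.
Qed.

Lemma threshold_epochs_sorted w :
  sorted <=%O [seq t <- success_epochs N U B w | a <= t].
Proof.
apply: (@subseq_sorted _ <=%O le_trans _ [seq epoch N U k w | k <- iota 0 (N w)]).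
  by rewrite threshold_epochs; apply: map_subseq; exact: filter_subseq.
apply/(sortedP 0) => i; rewrite size_map size_iota => iN.
rewrite !(nth_map 0%N) ?size_iota ?(ltnW iN)// !nth_iota ?(ltnW iN)// !add0n.
by apply: epoch_homo; rewrite leqnSn.
Qed.

Lemma threshold_range w : tau w = 1 \/
  exists k, [/\ (k < N w)%N, B k w, tau w = epoch N U k w & a <= epoch N U k w].
Proof.
rewrite /tau /threshold_strategy; case E : [seq t <- _ | _] => [|x l]; first by left.
right; have : x \in [seq t <- success_epochs N U B w | a <= t] by rewrite E mem_head.
by rewrite mem_filter => /andP[ax /success_epochP[k [kN Bk xk]]]; exists k; rewrite /= -xk.
Qed.

Lemma threshold_01 w : 0 <= tau w <= 1.
Proof.
case: (threshold_range w) => [->|[k [kN _ -> _]]]; first by rewrite ler01 lexx.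
exact: epoch_01.
Qed.

Lemma threshold_leP t w : t < 1 -> tau w <= t <->
  exists k, [/\ (k < N w)%N, B k w, a <= epoch N U k w & epoch N U k w <= t].
Proof.
move=> t1; split.
  case: (threshold_range w) => [->|[k [kN Bk -> ak]] kt]; first by rewrite leNgt t1.
  by exists k.
move=> [k [kN Bk ak kt]]; apply: le_trans kt.
have : epoch N U k w \in [seq t <- success_epochs N U B w | a <= t].
  by rewrite mem_filter ak; apply/success_epochP; exists k.
have := threshold_epochs_sorted w; rewrite /tau /threshold_strategy.
case: [seq t <- _ | _] => [//|x l] /= xl; rewrite inE => /orP[/eqP ->//|].
by have /allP := order_path_min le_trans xl; apply.
Qed.

(** The generators of the history only speak of epochs at most equal to a given
    time; [epoch < a] is the union of the events [epoch <= a - 1 / (i + 1)]. *)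
Lemma history_success_from t k : a <= t ->
  history N U B t [set w | [/\ (k < N w)%N, B k w, a <= epoch N U k w & epoch N U k w <= t]].
Proof.
move=> a_t; have t0 : 0 <= t <= t by rewrite lexx andbT (le_trans a_ge0).
have -> : [set w | [/\ (k < N w)%N, B k w, a <= epoch N U k w & epoch N U k w <= t]] =
  [set w | [/\ (k < N w)%N, epoch N U k w <= t & B k w]] `\`
  \bigcup_i [set w | (k < N w)%N /\ epoch N U k w <= a - i.+1%:R^-1].
  apply/seteqP; split => w /=.
    move=> [kN Bk ak kt]; split=> // -[i _ /= [_ ki]].
    by move: (le_trans ak ki); rewrite leNgt ltrBlDr ltrDl invr_gt0 ltr0n.
  move=> [[kN kt Bk] h]; split => //; rewrite leNgt; apply/negP => ka; apply: h.
  have ka0 : 0 < a - epoch N U k w by rewrite subr_gt0.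
  exists (Num.truncn (a - epoch N U k w)^-1) => //; split => //.
  rewrite lerBrDr -lerBrDl invf_ple ?posrE//.
  by apply: ltW; exact: truncnS_gt.
apply: historyD; first exact: history_success.
apply: history_bigcup => i; apply: history_before => //.
by rewrite lerBlDr (le_trans a_t)// lerDl invr_ge0.
Qed.

(** Before time 1 the strategy has stopped by [t] if and only if there is a
    success between [a] and [t]; at time 1 it always has. *)
Lemma threshold_adapted t : 0 <= t <= 1 -> history N U B t [set w | tau w <= t].
Proof.
move=> /andP[t0]; rewrite le_eqVlt => /predU1P[->|t1].
  rewrite (_ : [set w | _] = setT); first exact: historyT.
  by apply/seteqP; split => // w _; case/andP: (threshold_01 w).
rewrite (_ : [set w | _] = \bigcup_k
  [set w | [/\ (k < N w)%N, B k w, a <= epoch N U k w & epoch N U k w <= t]]).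
  apply: history_bigcup => k; have [at_|ta] := leP a t; first exact: history_success_from.
  rewrite (_ : [set w | _] = set0); first exact: history0.
  by apply/seteqP; split => // w [_ _ ak kt]; move: (le_trans ak kt); rewrite leNgt ta.
apply/seteqP; split => w.
  by move=> /(threshold_leP w t1) [k hk]; exists k.
by move=> [k _ hk]; apply/(threshold_leP w t1); exists k.
Qed.

Lemma threshold_measurable : measurable_fun setT tau.
Proof.
apply: (measurability _ (RGenOInfty.measurableE R)) => //.
move=> _ [_ [s ->] <-]; rewrite setTI.
have -> : tau @^-1` `]s, +oo[ = ~` [set w | tau w <= s].
  apply/seteqP; split => w /=; rewrite in_itv /= andbT ltNge; first by move/negP.
  by move=> /negP.
apply: measurableC; have [s0|s0] := leP 0 s; last first.
  rewrite (_ : [set w | _] = set0)//; apply/seteqP; split => // w /= h.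
  by have /andP[/le_trans/(_ h)] := threshold_01 w; rewrite leNgt s0.
have [s1|s1] := leP s 1.
  by apply: history_measurable; apply: threshold_adapted; rewrite s0.
rewrite (_ : [set w | _] = setT)//; apply/seteqP; split => // w _ /=.
by have /andP[_ /le_trans] := threshold_01 w; apply; exact: ltW.
Qed.

Lemma threshold_stopping : stopping_strategy N U B tau.
Proof.
split; [exact: threshold_measurable| |exact: threshold_adapted] => w.
case: (threshold_range w) => [->|[k [kN _ tk _]]]; first by left.
by right; exists k.
Qed.

Lemma single_success_wins :
  [set w | success_count N U B `[a, 1] w = 1%N] `<=` winning_event N U B tau.
Proof.
move=> w /= C1; set ks := [seq k <- iota 0 (N w) | B k w && (a <= epoch N U k w)].
have mem_ks k : (k \in ks) = [&& (k < N w)%N, B k w & a <= epoch N U k w].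
  by rewrite mem_filter mem_iota add0n /= andbC.
have : size ks = 1%N.
  rewrite -C1 -(size_map (fun k => epoch N U k w)) -threshold_epochs size_filter.
  apply: eq_in_count => x /success_epochP[k [kN _ ->]].
  have /andP[_ e1] := epoch_01 U01 kN.
  apply/idP/idP => [ak|/set_mem]; first by apply/mem_set; rewrite /= in_itv /= ak.
  by rewrite /= in_itv /= => /andP[].
case E : ks => [|k [|? ?]]// _.
have : k \in ks by rewrite E mem_head.
rewrite mem_ks => /and3P[kN Bk ak]; exists k; split => //.
  by rewrite /tau /threshold_strategy threshold_epochs -/ks E.
move=> j /andP[kj jN]; apply/negP => Bj; have : j \in ks.
  by rewrite mem_ks jN Bj (le_trans ak)// epoch_homo// (ltnW kj).
by rewrite E inE gtn_eqF.
Qed.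
End Threshold.

(** * The optimal value *)
Section OptimalValue.
Context d (T : measurableType d) (R : realType) (P : probability T R).
Variables (theta q : R).
Variables (N : {RV P >-> nat}) (U : nat -> {RV P >-> R}) (B : nat -> {RV P >-> bool}).
Hypothesis theta_gt0 : 0 < theta.
Hypothesis q01 : 0 < q < 1.
Hypothesis model : trials_model (negative_binomial_pmf theta q)
               (fun k => theta / (theta + k%:R - 1)) N U B.

Let U01 i w : 0 <= U i w <= 1 := uniform_range model i w.
Let alpha : R := 1 - expR (- theta^-1).
Let a : R := Num.max (1 - alpha / q) 0.
Let x : R := q - Num.max (q - alpha) 0.
Let H : R := total_hazard theta q.

(** The threshold [a] is positive exactly when the total integrated rate
    exceeds 1. *)
Lemma total_hazard_ge1 : (1 <= H) = (alpha <= q).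
Proof.
have /andP[q0 q1] := q01; have p0 : 0 < 1 - q by rewrite subr_gt0.
rewrite /H /total_hazard /alpha mulNr lerNr mulrC -ler_pdivlMr// mulN1r.
rewrite -[X in _ <= X]expRK ler_ln ?posrE ?expR_gt0//.
by rewrite lerBlDr addrC -lerBlDr.
Qed.

Let alpha_gt0 : 0 < alpha.
Proof. by rewrite subr_gt0 -expR0 ltr_expR oppr_lt0 invr_gt0. Qed.

Lemma threshold_ge0 : 0 <= a < 1.
Proof.
have /andP[q0 q1] := q01; rewrite le_max lexx orbT /= gt_max ltr01 andbT.
by rewrite ltrBlDr ltrDl divr_gt0.
Qed.

Lemma hazard_threshold : hazard theta q a = Num.min H 1.
Proof.
have /andP[q0 q1] := q01; have h := total_hazard_ge1; rewrite /a.
have [H1|H1] := leP 1 H.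
  have H01 : 0 <= (1 : R) <= total_hazard theta q by rewrite ler01.
  have /andP[a0 _] := hazard_time_01 theta_gt0 q01 H01.
  have e : 1 - alpha / q = hazard_time theta q 1 by rewrite /hazard_time /alpha mulN1r.
  by rewrite e max_l// hazard_timeK.
rewrite max_r; first by rewrite hazard_le0.
by rewrite subr_le0 ler_pdivlMr// mul1r ltW// ltNge -h -ltNge.
Qed.

Lemma last_success_valueE : last_success_value H = hazard theta q a * expR (- hazard theta q a).
Proof.
rewrite hazard_threshold /last_success_value; have [H1|H1] := leP H 1; first by [].
by rewrite mul1r.
Qed.

(** The probability of a single success after the threshold is already the upper
    bound, so it is the exact winning probability. *)
Lemma threshold_value :
  P (winning_event N U B (threshold_strategy N U B a)) = (last_success_value H)%:E.
Proof.
have /andP[a0 a1] := threshold_ge0.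
have strat := threshold_stopping N B U01 a0.
apply/eqP; rewrite eq_le (strategy_upper_bound theta_gt0 q01 model strat)/=.
have sub : `[a, 1]%classic `<=` `[0, 1].
  by apply: subset_itvr; rewrite bnd_simp.
have mean : mean_count theta q `[a, 1] = hazard theta q a.
  apply/EFin_inj; rewrite -mean_countE//.
  by apply: integral_rate_cc; rewrite ?a0.
have := count_law theta_gt0 q01 model 1 (measurable_itv `[a, 1]) sub.
rewrite mean expr1 divr1 -last_success_valueE => <-.
apply: le_measure; rewrite ?inE; [|exact: winning_measurable (strategy_measurable strat)|].
  have := measurable_success_count N U B (measurable_itv `[a, 1]) measurableT (Y := [set 1%N]).
  by rewrite setTI; apply.
exact: single_success_wins.
Qed.

Lemma threshold_optimal : optimal_strategy P N U B (threshold_strategy N U B a).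
Proof.
have /andP[a0 _] := threshold_ge0; split; first exact: threshold_stopping.
by move=> sigma; rewrite threshold_value; exact: strategy_upper_bound.
Qed.

Lemma optimal_value : optimal_winning_probability P N U B = (last_success_value H)%:E.
Proof.
have [strat _] := threshold_optimal.
apply/eqP; rewrite eq_le; apply/andP; split.
  by apply: ge_ereal_sup => _ [sigma hs <-]; exact: strategy_upper_bound.
by apply: ereal_sup_ubound; exists (threshold_strategy N U B a) => //; exact: threshold_value.
Qed.

Lemma last_success_value_ge1 : 1 <= H -> last_success_value H = (expR 1)^-1.
Proof.
rewrite /last_success_value -expRN; have [H1|//] := leP H 1.
by move=> H1'; have -> : H = 1 by [apply/eqP; rewrite eq_le H1]; rewrite mul1r.
Qed.

(** By the choice of [x], [- theta * ln (1 - x)] is the integrated rate beyond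
    the threshold, and [(1 - x)^theta] its negative exponential. *)
Lemma last_success_value_powR :
  last_success_value H = - theta * (1 - x) `^ theta * ln (1 - x).
Proof.
have /andP[q0 q1] := q01; have h := total_hazard_ge1.
have [x1 e] : 0 < 1 - x /\ hazard theta q a = - theta * ln (1 - x).
  rewrite hazard_threshold /x; have [aq|qa] := leP alpha q.
    rewrite max_l ?subr_ge0// min_r ?h//.
    rewrite (_ : 1 - _ = expR (- theta^-1)); last by rewrite /alpha; ring.
    by rewrite expR_gt0 expRK mulrNN mulfV ?gt_eqF.
  rewrite max_r ?subr_le0 ?(ltW qa)// subr0 subr_gt0 min_l//.
  by rewrite ltW// ltNge h -ltNge.
rewrite last_success_valueE e /powR gt_eqF// [RHS]mulrAC; congr (_ * expR _).
by rewrite mulNr opprK.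
Qed.
End OptimalValue.

Theorem mainTheorem3 (d : measure_display) (T : measurableType d)
    (R : realType) (P : probability T R) (theta q : R)
    (N : {RV P >-> nat}) (U : nat -> {RV P >-> R}) (B : nat -> {RV P >-> bool})
    (theta_gt0 : 0 < theta) (q01 : 0 < q < 1)
    (model : trials_model (negative_binomial_pmf theta q)
               (fun k => theta / (theta + k%:R - 1)) N U B) :
  let alpha := 1 - expR (- theta^-1) in
  let a := Num.max (1 - alpha / q) 0 in
  let x := q - Num.max (q - alpha) 0 in
  [/\ poisson_process P (success_count N U B) `[0, 1]
        (fun t => theta / (t + q^-1 - 1)),
      optimal_strategy P N U B (threshold_strategy N U B a),
      optimal_winning_probability P N U B =
        (- theta * (1 - x) `^ theta * ln (1 - x))%:E &
      alpha <= q -> optimal_winning_probability P N U B = (expR 1)^-1%:E].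
Proof.
move=> alpha a x; split.
- exact: success_poisson_process.
- exact: (threshold_optimal theta_gt0).
- by rewrite (optimal_value theta_gt0 q01 model) last_success_value_powR.
- move=> aq; rewrite (optimal_value theta_gt0 q01 model) last_success_value_ge1//.
  by rewrite total_hazard_ge1.
Qed.
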